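(* Fix $L\ge 20$. For any pattern $(\mathbf a,\mathbf e)$ there exists $S\subseteq V(\Gamma)$ such that \[\tilde p((\mathbf a,\mathbf e)_S)\ge \frac{p(\mathbf a,\mathbf e)}{2}-55L\sqrt d\] and, for $G$ a random $n$-lift of $H$, \[\mathbb{P}\big((\mathbf a,\mathbf e)_S\text{ can be found in }G\big)\le C\prod_{(i,w)\in S,\,a_{i,w}>0}a_{i,w}^{d/4}\Big(\prod_{(i,w)\in S,\,a_{i,w}>0}\binom{n}{\min(a_{i,w},\lfloor n/2\rfloor)}\Big)^{1-L/10},\] where $C$ is a constant not depending on $n$ or on the pattern.
   Context: $d\ge2$ and $H$ is a $d$-regular graph on $[h]$. A random $n$-lift $G$ of $H$ has vertex set $\{(i,j):i\in[h],j\in[n]\}$, fibres $V_i=\{(i,j):j\in[n]\}$, and for each $ii'\in E(H)$ an independent uniformly random perfect matching between $V_i$ and $V_{i'}$ (no other edges). Let $D^{>0}=\{2^k/\sqrt{nh}:k\in\mathbb{Z},k\ge0\}$ and let $\Gamma$ be the graph on $[h]\times D^{>0}$ with $(i,w)\sim_\Gamma(i',w')$ iff $ii'\in E(H)$ and $w/w'\in(d^{-1/2},d^{1/2})$. A pattern is a pair $(\mathbf a,\mathbf e)$: $\mathbf a=(a_{i,w})_{(i,w)\in V(\Gamma)}$ nonnegative integers with $\sum_w a_{i,w}\le n$ for each $i$, $\sum w^2a_{i,w}\le10$, and some $w_0\in D^{>0}$ with $a_{i,w}=0$ unless $w_0\le w\le dw_0$; $\mathbf e=(e_{i,w,i',w'})$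 indexed by edges of $\Gamma$ (symmetric), integers with $0\le e_{i,w,i',w'}\le\min(a_{i,w},a_{i',w'})$. It can be found in $G$ if there are pairwise disjoint $A_{i,w}\subseteq V_i$ with $|A_{i,w}|=a_{i,w}$ and exactly $e_{i,w,i',w'}$ edges of $G$ between $A_{i,w}$ and $A_{i',w'}$ for each edge $(i,w)(i',w')$ of $\Gamma$. Potency: $p(\mathbf a,\mathbf e)=\big|\sum_{(i,w)(i',w')\in E(\Gamma)}ww'(e_{i,w,i',w'}-a_{i,w}a_{i',w'}/n)\big|$; also $\tilde p(\mathbf a,\mathbf e)=\max_{F\subseteq E(\Gamma)}\big|\sum_{(i,w)(i',w')\in F}ww'(e_{i,w,i',w'}-a_{i,w}a_{i',w'}/n)\big|$. For $S\subseteq V(\Gamma)$, the sub-pattern $(\mathbf a,\mathbf e)_S$ has $a'_{i,w}=a_{i,w}$ if $(i,w)\in S$ and $0$ otherwise, and $e'_{i,w,i',w'}=e_{i,w,i',w'}$ if both endpoints lie in $S$ and $0$ otherwise. *)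

(* Defs.v *)
From Stdlib Require Import Reals ClassicalEpsilon.
From mathcomp Require Import all_boot.

Set Implicit Arguments.
Unset Strict Implicit.
Unset Printing Implicit Defensive.

Local Open Scope R_scope.

Definition d_regular (h d : nat) (adj : rel 'I_h) : Prop :=
  [/\ (forall i j, adj i j = adj j i), (forall i, adj i i = false)
    & (forall i, #|[set j | adj i j]| = d)%N].

(* A weight is represented by its exponent k : nat. *)
Definition wt (n h k : nat) : R := (pow 2 k / sqrt (INR n * INR h)).

Definition pbool (P : Prop) : bool := if excluded_middle_informative P then true else false.

Definition Rltb (x y : R) : bool := if Rlt_dec x y then true else false.

Definition wadj (n h d k k' : nat) : bool :=
  Rltb (/ sqrt (INR d)) (wt n h k / wt n h k') &&
  Rltb (wt n h k / wt n h k') (sqrt (INR d)).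

Definition gadj h (adj : rel 'I_h) (n d : nat) (i : 'I_h) (k : nat) (i' : 'I_h) (k' : nat) : bool :=
  adj i i' && wadj n h d k k'.

(* a i k = a_{i, w_k};  e i k i' k' = e_{i,w_k,i',w_k'} (only its values on edges of
   Gamma are meaningful).  k0 encodes the w_0 of the definition (w_0 = 2^k0/sqrt(nh)). *)
Definition Kbound (d k0 : nat) : nat := (k0 + d).+1.

Definition is_pattern h (adj : rel 'I_h) (n d : nat)
   (a : 'I_h -> nat -> nat) (e : 'I_h -> nat -> 'I_h -> nat -> nat) (k0 : nat) : Prop :=
  (forall i k, ~ (wt n h k0 <= wt n h k <= INR d * wt n h k0) -> a i k = 0%N)
  (* (all k outside the window have a = 0, so these finite sums are the full sums) *)
  /\ (forall i, \sum_(k < Kbound d k0) a i k <= n)%N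
  /\ (\big[Rplus/0]_(i : 'I_h) \big[Rplus/0]_(k < Kbound d k0)
         (wt n h k ^ 2 * INR (a i k)) <= 10)
  /\ (forall i k i' k', gadj adj n d i k i' k' ->
         e i k i' k' = e i' k' i k /\ (e i k i' k' <= minn (a i k) (a i' k'))%N).

Definition pterm (n h : nat) (a : 'I_h -> nat -> nat) (e : 'I_h -> nat -> 'I_h -> nat -> nat)
   (i : 'I_h) (k : nat) (i' : 'I_h) (k' : nat) : R :=
  (wt n h k * wt n h k' * (INR (e i k i' k') - INR (a i k) * INR (a i' k') / INR n)).

(* Edges of Gamma inside the window [0, K): unordered edges are listed once, as
   (i,k,i',k') with i < i' (H has no loops, so i <> i' on every edge). *)
Definition gedge h (adj : rel 'I_h) (n d K : nat) (x : 'I_h * 'I_K * 'I_h * 'I_K) : bool :=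
  let: (i, k, i', k') := x in (i < i')%N && gadj adj n d i k i' k'.

Definition fsum h (adj : rel 'I_h) (n d K : nat) (a : 'I_h -> nat -> nat)
   (e : 'I_h -> nat -> 'I_h -> nat -> nat) (F : {set 'I_h * 'I_K * 'I_h * 'I_K}) : R :=
  \big[Rplus/0]_(x in F | gedge adj n d x)
     (let: (i, k, i', k') := x in pterm n a e i k i' k').

Definition potency h (adj : rel 'I_h) (n d K : nat) a e : R :=
  Rabs (fsum adj n d a e [set: 'I_h * 'I_K * 'I_h * 'I_K]).

Definition potency_tilde h (adj : rel 'I_h) (n d K : nat) a e : R :=
  \big[Rmax/0]_(F : {set 'I_h * 'I_K * 'I_h * 'I_K}) Rabs (fsum adj n d a e F).

Definition sub_a h (S : 'I_h -> nat -> bool) (a : 'I_h -> nat -> nat) : 'I_h -> nat -> nat :=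
  fun i k => if S i k then a i k else 0%N.
Definition sub_e h (S : 'I_h -> nat -> bool) (e : 'I_h -> nat -> 'I_h -> nat -> nat) :
  'I_h -> nat -> 'I_h -> nat -> nat :=
  fun i k i' k' => if S i k && S i' k' then e i k i' k' else 0%N.

(* A lift is given by a bijection s(i,i') : V_i -> V_i' for each pair i < i'
   (only pairs that are edges of H are used; the others are independent dummy
   coordinates, which does not change any probability).  Vertex (i,j) is written
   as the pair of i : 'I_h and j : 'I_n. *)
Definition lift_space (h n : nat) := {ffun 'I_h * 'I_h -> {ffun 'I_n -> 'I_n}}.

Definition lift_valid h n (s : lift_space h n) : bool := [forall x, injectiveb (s x)].

Definition ledge h n (adj : rel 'I_h) (s : lift_space h n) (i : 'I_h) (j : 'I_n)
   (i' : 'I_h) (j' : 'I_n) : bool :=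
  adj i i' && (if (i < i')%N then s (i, i') j == j' else s (i', i) j' == j).

Definition nedges h n (adj : rel 'I_h) (s : lift_space h n) (i : 'I_h) (A : {set 'I_n})
   (i' : 'I_h) (B : {set 'I_n}) : nat :=
  #|[set x : 'I_n * 'I_n | [&& x.1 \in A, x.2 \in B & ledge adj s i x.1 i' x.2]]|%N.

Definition found h n (adj : rel 'I_h) (d : nat) (s : lift_space h n)
   (a : 'I_h -> nat -> nat) (e : 'I_h -> nat -> 'I_h -> nat -> nat) : Prop :=
  exists A : 'I_h -> nat -> {set 'I_n},
    (forall i k, #|A i k| = a i k)%N
    /\ (forall i k k', k <> k' -> [disjoint A i k & A i k'])
    /\ (forall i k i' k', gadj adj n d i k i' k' -> nedges adj s i (A i k) i' (A i' k') = e i k i' k')%N.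

Definition prob_found h n (adj : rel 'I_h) (d : nat) a e : R :=
  (INR #|[set s : lift_space h n | lift_valid s && pbool (found adj d s a e)]|
   / INR #|[set s : lift_space h n | lift_valid s]|).

(* Main.v *)
(* Let c(f) = e ln(e/mu) - e + mu, mu = a a'/n, be the large-deviation cost of an edge f of
   Gamma and l(v) = ln C(n, min(a_v, n/2)) the entropy of a vertex v.

   For fixed disjoint sets, a matching has the prescribed edge counts with probability at
   most exp(- sum c) up to a factor polynomial in the a_v: tilt each edge by z = e/mu, and
   group the permutations by the colouring of the points by the set containing their image.
   The colouring being balanced, the weights can be multiplied by the sizes of the colour
   classes, so that the sum over colourings factorises.  The union bound over the sets
   costs exp(sum l), and the polynomial factors are absorbed by another exp(sum l).

   Delete vertices v as long as the cost of the remaining edges at v is below (L/2) l(v).  The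
   surviving edges cost at least (L/4) sum l, and 2 - L/4 <= 1 - L/10.  The edges lost with v are
   controlled by Fenchel's inequality |e - mu| t <= c + mu t^2 e^t with
   t = w w'/lambda_v, lambda_v = 4 sqrt d w (w + rho_i) / ln(e n/a_v), where rho_i^2 is
   the average of the squared weight over the n points of the fibre i.  The term rho_i makes the sum of
   mu t^2 e^t over the scales w at the fibre i telescope, whatever their number; in total
   the potency decreases by at most 40 L sqrt d + 45 sqrt d. *)

Require Import Defs.
From Stdlib Require Import Reals ClassicalEpsilon Lra.
From HB Require Import structures.
From mathcomp Require Import all_boot all_fingroup.

Set Implicit Arguments.
Unset Strict Implicit.
Unset Printing Implicit Defensive.

Local Open Scope R_scope.

(** * Sums and products of real numbers as big operators *)

Lemma RplusA : associative Rplus. Proof. by move=> x y z; ring. Qed.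
Lemma RmultA : associative Rmult. Proof. by move=> x y z; ring. Qed.

HB.instance Definition _ :=
  Monoid.isComLaw.Build R 0 Rplus RplusA Rplus_comm Rplus_0_l.
HB.instance Definition _ :=
  Monoid.isComLaw.Build R 1 Rmult RmultA Rmult_comm Rmult_1_l.
HB.instance Definition _ :=
  Monoid.isMulLaw.Build R 0 Rmult Rmult_0_l Rmult_0_r.
HB.instance Definition _ :=
  Monoid.isAddLaw.Build R Rmult Rplus Rmult_plus_distr_r Rmult_plus_distr_l.

Section BigReal.
Context {I : Type}.
Implicit Types (r : seq I) (P : pred I) (F G : I -> R).

Lemma Rsum_le r P F G : (forall i, P i -> F i <= G i) ->
  \big[Rplus/0]_(i <- r | P i) F i <= \big[Rplus/0]_(i <- r | P i) G i.
Proof.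
by move=> le_FG; apply: big_ind2 => [|x x' y y' xx' yy'|//]; [exact: Rle_refl | lra].
Qed.

Lemma Rsum_ge0 r P F : (forall i, P i -> 0 <= F i) ->
  0 <= \big[Rplus/0]_(i <- r | P i) F i.
Proof. by move=> F_ge0; apply: big_ind => // [|x y]; lra. Qed.

Lemma Rabs_sum_le r P F :
  Rabs (\big[Rplus/0]_(i <- r | P i) F i) <= \big[Rplus/0]_(i <- r | P i) Rabs (F i).
Proof.
elim/big_rec2: _ => [|i x y _ xy]; first by rewrite Rabs_R0; lra.
by apply: Rle_trans (Rabs_triang _ _) _; lra.
Qed.

Lemma Rprod_ge0 r P F : (forall i, P i -> 0 <= F i) ->
  0 <= \big[Rmult/1]_(i <- r | P i) F i.
Proof. by move=> F_ge0; apply: big_ind => // [|x y]; [lra | exact: Rmult_le_pos]. Qed.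

Lemma Rprod_gt0 r P F : (forall i, P i -> 0 < F i) ->
  0 < \big[Rmult/1]_(i <- r | P i) F i.
Proof. by move=> F_gt0; apply: big_ind => // [|x y]; [lra | exact: Rmult_lt_0_compat]. Qed.

Lemma Rprod_ge1 r P F : (forall i, P i -> 1 <= F i) ->
  1 <= \big[Rmult/1]_(i <- r | P i) F i.
Proof. by move=> F_ge1; apply: big_ind => // [|x y]; [lra | nra]. Qed.

Lemma Rprod_le r P F G : (forall i, P i -> 0 <= F i <= G i) ->
  \big[Rmult/1]_(i <- r | P i) F i <= \big[Rmult/1]_(i <- r | P i) G i.
Proof.
move=> FG; suff: 0 <= \big[Rmult/1]_(i <- r | P i) F i <=
   \big[Rmult/1]_(i <- r | P i) G i by case.
elim/big_rec2: _ => [|i x y /FG]; first by lra.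
by move=> ? ?; split; [apply: Rmult_le_pos | apply: Rmult_le_compat]; lra.
Qed.

Lemma exp_Rsum r P F :
  exp (\big[Rplus/0]_(i <- r | P i) F i) = \big[Rmult/1]_(i <- r | P i) exp (F i).
Proof. by apply: (big_morph exp exp_plus exp_0). Qed.

Lemma INR_sum r P (f : I -> nat) :
  INR (\sum_(i <- r | P i) f i) = \big[Rplus/0]_(i <- r | P i) INR (f i).
Proof. by apply: (big_morph INR) => // x y; rewrite plus_INR. Qed.

Lemma INR_prod r P (f : I -> nat) :
  INR (\prod_(i <- r | P i) f i) = \big[Rmult/1]_(i <- r | P i) INR (f i).
Proof. by apply: (big_morph INR) => // x y; rewrite mult_INR. Qed.

Lemma Ropp_sum r P F :
  - (\big[Rplus/0]_(i <- r | P i) F i) = \big[Rplus/0]_(i <- r | P i) - F i.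
Proof. by apply: (big_morph Ropp) => [x y|]; ring. Qed.

End BigReal.

Lemma leq_INR m n : (m <= n)%N -> INR m <= INR n.
Proof. by move=> /leP; exact: le_INR. Qed.

Lemma INR_ge1 m : (0 < m)%N -> 1 <= INR m.
Proof. by move=> m0; rewrite -INR_1; apply: leq_INR. Qed.

Lemma Rsum_const (I : finType) (P : pred I) x :
  \big[Rplus/0]_(i | P i) x = INR #|P| * x.
Proof.
rewrite big_const; elim: #|P| => [|m IH]; first by rewrite /=; ring.
by rewrite iterS IH S_INR; ring.
Qed.

Lemma Rprod_const (I : finType) (P : pred I) x :
  \big[Rmult/1]_(i | P i) x = pow x #|P|.
Proof. by rewrite big_const; elim: #|P| => //= m ->. Qed.

Lemma le_bigRmax (I : finType) (F : I -> R) i : F i <= \big[Rmax/0]_j F j.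
Proof.
have: i \in index_enum I by rewrite mem_index_enum.
elim: (index_enum I) => // j s IH; rewrite in_cons big_cons => /predU1P[<-|/IH le].
  exact: Rmax_l.
exact: Rle_trans le (Rmax_r _ _).
Qed.

(** * The function m! e^m / m^m *)

(** The polynomial loss in replacing [m!] by [(m/e)^m]. Since [pow 0 0 = 1], the value at 0 is 1. *)
Definition stirling_ratio (m : nat) : R := INR m`! * exp (INR m) / pow (INR m) m.

Lemma pow_self_gt0 m : 0 < pow (INR m) m.
Proof.
case: m => [|m]; first by rewrite /=; lra.
by apply: pow_lt; rewrite S_INR; have := pos_INR m; lra.
Qed.

Lemma INR_fact_gt0 m : 0 < INR m`!.
Proof. by have := INR_ge1 (fact_gt0 m); lra. Qed.

Lemma stirling_ratio_gt0 m : 0 < stirling_ratio m.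
Proof.
apply: Rdiv_lt_0_compat; last exact: pow_self_gt0.
by apply: Rmult_lt_0_compat; [exact: INR_fact_gt0 | exact: exp_pos].
Qed.

Lemma exp_INR x m : exp (INR m * x) = pow (exp x) m.
Proof.
elim: m => [|m IH]; first by rewrite Rmult_0_l exp_0.
by rewrite S_INR Rmult_plus_distr_r Rmult_1_l exp_plus IH /= Rmult_comm.
Qed.

Lemma exp_ge1x x : 1 + x <= exp x.
Proof. 
case: (Req_dec x 0) => [->|x0]; first by rewrite exp_0; lra.
by have := exp_ineq1 x x0; lra.
Qed.

(** Consecutive values have ratio [e / (1 + 1/m)^m]. Monotonicity and the linear bound then come
    from [(1 + 1/m)^m <= e <= (1 + 1/m)^(m+1)]. *)
Lemma stirling_ratioS m : (0 < m)%N ->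
  stirling_ratio m.+1 * pow (1 + / INR m) m = stirling_ratio m * exp 1.
Proof.
move=> m0; have mR := INR_ge1 m0.
have -> : 1 + / INR m = INR m.+1 / INR m by rewrite S_INR; field; lra.
have S0 : INR m.+1 <> 0 by rewrite S_INR; lra.
rewrite /stirling_ratio Rpow_mult_distr pow_inv factS mult_INR [in exp _]S_INR exp_plus.
rewrite -[pow (INR m.+1) m.+1]/(INR m.+1 * pow (INR m.+1) m).
field; split; first by apply: pow_nonzero; lra.
by split => //; apply: pow_nonzero.
Qed.

Lemma stirling_ratio_le : {homo stirling_ratio : m n / (m <= n)%N >-> m <= n}.
Proof.
suff step m : stirling_ratio m <= stirling_ratio m.+1.
  move=> m n /subnK <-; elim: (n - m)%N => [|k IH]; first exact: Rle_refl.
  exact: Rle_trans IH (step _).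
case: m => [|m].
  rewrite /stirling_ratio /= exp_0 /Rdiv !Rmult_1_r !Rmult_1_l Rinv_1.
  by have := exp_ge1x 1; lra.
have mR := INR_ge1 (ltn0Sn m).
have p0 : 0 < 1 + / INR m.+1 by have := Rinv_0_lt_compat (INR m.+1); lra.
have le_pow : pow (1 + / INR m.+1) m.+1 <= exp 1.
  have -> : 1 = INR m.+1 * / INR m.+1 by field; lra.
  rewrite exp_INR; apply: pow_incr; split; last by rewrite Rinv_r; [exact: exp_ge1x | lra].
  by rewrite Rinv_r; lra.
have := stirling_ratioS (ltn0Sn m).
have := stirling_ratio_gt0 m.+2; have := stirling_ratio_gt0 m.+1.
have := pow_lt _ m.+1 p0; have := exp_pos 1.
by move: (pow _ _) (exp 1) le_pow (stirling_ratio _) (stirling_ratio _) => *; nra.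
Qed.

Lemma stirling_ratio_ge1 m : 1 <= stirling_ratio m.
Proof.
have -> : 1 = stirling_ratio 0.
  by rewrite /stirling_ratio fact0 /= exp_0; field.
exact: stirling_ratio_le.
Qed.

Lemma stirling_ratio_linear m : stirling_ratio m <= exp 1 * (INR m + 1).
Proof.
suff bd k : stirling_ratio k.+1 <= exp 1 * INR k.+1.
  case: m => [|m].
    rewrite /stirling_ratio fact0 /= exp_0; have := exp_ge1x 1; lra.
  by apply: Rle_trans (bd m) _; have := exp_pos 1; nra.
elim: k => [|k IH].
  by rewrite /stirling_ratio /= !Rmult_1_r /Rdiv Rinv_1; lra.
have kR := INR_ge1 (ltn0Sn k); set x := INR k.+1 in IH kR *.
have x1 : 0 < / x by apply: Rinv_0_lt_compat; lra.
(* From [exp (-1/(x+1)) >= 1 - 1/(x+1) = 1/(1 + 1/x)] one gets [exp (1/(x+1)) <= 1 + 1/x], which is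
   raised to the power [x + 1]. *)
have le_pow : exp 1 <= pow (1 + / x) k.+2.
  have -> : 1 = INR k.+2 * / INR k.+2 by field; rewrite S_INR -/x; lra.
  rewrite exp_INR; apply: pow_incr; split; first by apply: Rlt_le; exact: exp_pos.
  have -> : INR k.+2 * / INR k.+2 = 1 by field; rewrite S_INR -/x; lra.
  rewrite S_INR -/x.
  have := exp_ge1x (- / (x + 1)); rewrite exp_Ropp.
  have -> : 1 + - / (x + 1) = / (1 + / x) by field; lra.
  move=> h; apply: Rnot_lt_le => h2; move: h.
  by apply: Rlt_not_le; apply: Rinv_lt_contravar => //; apply: Rmult_lt_0_compat; lra.
have step := stirling_ratioS (ltn0Sn k); rewrite -/x in step.
have g2 := stirling_ratio_gt0 k.+2; have e0 := exp_pos 1.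
rewrite [INR k.+2]S_INR -/x.
rewrite -[pow (1 + / x) k.+2]/((1 + / x) * pow (1 + / x) k.+1) in le_pow.
have p0 : 0 < pow (1 + / x) k.+1 by apply: pow_lt; lra.
apply: (Rmult_le_reg_r _ _ _ p0); rewrite step.
apply: Rle_trans (_ : exp 1 * x * exp 1 <= _).
  by apply: Rmult_le_compat_r; lra.
have -> : exp 1 * (x + 1) * pow (1 + / x) k.+1 =
  exp 1 * x * ((1 + / x) * pow (1 + / x) k.+1) by field; lra.
by apply: Rmult_le_compat_l => //; nra.
Qed.

(** * Permutations with a prescribed table of counts *)

Section ColouredPermutations.
Variables (T Col : finType) (s : T -> Col).

Let fibre c := [set k | s k == c].

(** A colour-preserving permutation is determined by its restrictions to the colour classes, each a
    permutation of its class. *)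
Lemma card_colour_stabiliser :
  (#|[set t : {perm T} | [forall k, s (t k) == s k]]| <= \prod_c #|fibre c|`!)%N.
Proof.
pose f (t : {perm T}) := [ffun c => restr_perm (fibre c) t].
have stab (t : {perm T}) : [forall k, s (t k) == s k] ->
    forall c, t \in 'N(fibre c | 'P)%g.
  move=> /forallP st c; rewrite !inE /= ; apply/subsetP => k.
  by rewrite !inE /= apermE (eqP (st k)).
rewrite -(card_in_imset (f := f)); last first.
  move=> t u; rewrite !inE => st su /ffunP tu; apply/permP => k.
  have := tu (s k); rewrite !ffunE => /permP/(_ k).
  by rewrite !restr_permE ?stab ?inE.
have -> : (\prod_c #|fibre c|`! = #|family (fun c => perm_on (fibre c))|)%N.
  by rewrite card_family foldrE big_map big_enum; apply: eq_bigr => c _; rewrite card_perm.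
apply/subset_leq_card/subsetP => _ /imsetP[t _ ->].
by apply/familyP => c; rewrite ffunE; exact: restr_perm_on.
Qed.

(** If some [u] induces the colouring [c], composing with the inverse of [u] carries all such
    permutations injectively into the stabiliser. *)
Lemma card_colour_coset (c : {ffun T -> Col}) :
  (#|[set t : {perm T} | [ffun k => s (t k)] == c]| <= \prod_c #|fibre c|`!)%N.
Proof.
have [/= u /eqP uc|none] := pickP [pred t : {perm T} | [ffun k => s (t k)] == c]; last first.
  by rewrite eq_card0 // => t; rewrite !inE; exact: none.
apply: leq_trans card_colour_stabiliser.
rewrite -[X in (X <= _)%N](card_imset _ (@mulgI _ (u^-1)%g)).
apply/subset_leq_card/subsetP => _ /imsetP[t /[!inE] /eqP tc ->].
apply/forallP => k; rewrite permM; have /ffunP/(_ ((u^-1)%g k)) := tc.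
by rewrite -uc !ffunE permKV => ->.
Qed.

(** A bound for the permanent of the matrix [y j (s k)]. A permutation takes each colour [c] exactly
    [#|fibre c|] times, so the product of powers splits into one factor [#|fibre (s (t j))|] per
    point [j]. Grouping the permutations by colouring costs the factorials, and enlarging the sum to
    all colourings, balanced or not, makes it factorise. *)
Lemma sum_perm_colour_le (y : T -> Col -> R) : (forall j c, 0 <= y j c) ->
  (\big[Rplus/0]_(t : {perm T}) \big[Rmult/1]_j y j (s (t j)))
    * \big[Rmult/1]_c pow (INR #|fibre c|) #|fibre c|
  <= (\big[Rmult/1]_c INR #|fibre c|`!)
    * \big[Rmult/1]_j \big[Rplus/0]_c (INR #|fibre c| * y j c).
Proof.
move=> y0; rewrite [X in X <= _]big_distrl /=.
pose G (c : {ffun T -> Col}) := \big[Rmult/1]_j (INR #|fibre (c j)| * y j (c j)).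
have G0 c : 0 <= G c by apply: Rprod_ge0 => j _; apply: Rmult_le_pos => //; exact: pos_INR.
have term (t : {perm T}) :
    (\big[Rmult/1]_j y j (s (t j))) * \big[Rmult/1]_c pow (INR #|fibre c|) #|fibre c|
    = G [ffun k => s (t k)].
  rewrite /G big_split /= Rmult_comm; congr (_ * _); last first.
    by apply: eq_bigr => j _; rewrite ffunE.
  rewrite (eq_bigr (fun j => INR #|fibre (s (t j))|)); last by move=> j _; rewrite ffunE.
  rewrite -(reindex_inj (h := t) (P := xpredT)
    (F := fun k => INR #|fibre (s k)|)) /=; last exact: perm_inj.
  rewrite (partition_big s xpredT) //=; apply: eq_bigr => c _.
  rewrite (eq_bigr (fun _ => INR #|fibre c|)); last by move=> k /eqP ->.
  by rewrite Rprod_const cardsE.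
rewrite (eq_bigr _ (fun t _ => term t)).
rewrite (partition_big (fun t : {perm T} => [ffun k => s (t k)]) xpredT) //=.
rewrite bigA_distr_bigA /= big_distrr /=; apply: Rsum_le => c _.
rewrite (eq_bigr (fun _ => G c)); last by move=> t /eqP ->.
rewrite Rsum_const; apply: Rmult_le_compat_r => //.
rewrite -INR_prod; apply: leq_INR; apply: leq_trans (card_colour_coset c).
by apply/eq_leq/eq_card => t; rewrite !inE.
Qed.

End ColouredPermutations.

(** * Exponential tilting and the number of permutations with a given table *)

Lemma big_option (T : Type) (idx : T) (op : Monoid.com_law idx) (I : finType)
    (F : option I -> T) :
  \big[op/idx]_c F c = op (F None) (\big[op/idx]_i F (Some i)).
Proof.
rewrite (bigD1 None) //=; congr (op _ _).
rewrite (reindex_omap Some id) /=; last by case.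
by apply: eq_bigl => i; rewrite eqxx.
Qed.

(** The rate function of a Poisson variable of mean [a b / n]. At [e = 0] the logarithm is
    multiplied by 0, so the cost there is the mean. *)
Definition edge_cost (n a b e : nat) : R :=
  INR e * ln (INR e / (INR a * INR b / INR n)) - INR e + INR a * INR b / INR n.

(* Reweighting by [tilt] turns the expected count [a * b / n] into [e]. *)
Definition tilt (n a b e : nat) : R := INR e / (INR a * INR b / INR n).

Lemma tilt_ge0 n a b e : 0 <= tilt n a b e.
Proof.
apply: Rmult_le_pos; first exact: pos_INR.
have: 0 <= INR a * INR b / INR n.
  apply: Rmult_le_pos; first by apply: Rmult_le_pos; exact: pos_INR.
  case: n => [|n]; first by rewrite Rinv_0; lra.
  by apply/Rlt_le/Rinv_0_lt_compat; have := INR_ge1 (ltn0Sn n); lra.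
by case=> [h|<-]; [apply/Rlt_le/Rinv_0_lt_compat | rewrite Rinv_0; lra].
Qed.

Section Tilt.
Variables n a b e : nat.
Hypotheses (an : (a <= n)%N) (eab : (e <= minn a b)%N).

Let pos : (0 < e)%N -> [/\ 1 <= INR e, 1 <= INR a, 1 <= INR b & 1 <= INR n].
Proof.
move=> e0; have /andP[ea eb] : (e <= a)%N && (e <= b)%N by rewrite -leq_min.
have a0 := leq_trans e0 ea; split; apply: INR_ge1 => //.
- exact: leq_trans eb.
- exact: leq_trans an.
Qed.

Lemma pow_tilt_gt0 : 0 < pow (tilt n a b e) e.
Proof.
have [->|/pos[? ? ? ?]] := posnP e; first by rewrite /=; lra.
apply/pow_lt/Rdiv_lt_0_compat; first lra.
by apply: Rdiv_lt_0_compat; nra.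
Qed.

(** With [z = tilt n a b e] and [mu = a b / n], the identity [z mu = e] turns the exponent [e - mu]
    into [- edge_cost + e ln z]. For [e = 0] the tilt is 0 and [pow 0 0 = 1]. *)
Lemma exp_tilt :
  exp ((tilt n a b e - 1) * (INR a * INR b / INR n))
  = exp (- edge_cost n a b e) * pow (tilt n a b e) e.
Proof.
have [e0|e0] := posnP e.
  rewrite e0 /tilt /edge_cost /= Rmult_1_r; congr exp.
  by rewrite /Rdiv !Rmult_0_l; ring.
have [? ? ? ?] := pos e0.
have m0 : 0 < INR a * INR b / INR n by apply: Rdiv_lt_0_compat; nra.
have z0 : 0 < tilt n a b e by apply: Rdiv_lt_0_compat; lra.
rewrite -{2}(exp_ln _ z0) -exp_INR -exp_plus; congr exp.
by rewrite /edge_cost -/(tilt n a b e) {1}/tilt; field; split; [|split]; lra.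
Qed.

End Tilt.

Section TableCount.
Variables (T I : finType) (A B : I -> {set T}) (E : rel I) (e : I -> I -> nat).
Let n := #|T|.
Hypothesis disA : forall r s, r != s -> [disjoint A r & A s].
Hypothesis disB : forall r s, r != s -> [disjoint B r & B s].
Hypothesis e_le : forall r s, E r s -> (e r s <= minn #|A r| #|B s|)%N.

(** The colour [None] collects the points outside every [B x]. *)
Let colour (k : T) : option I := [pick x | k \in B x].

Let colourE k x : (colour k == Some x) = (k \in B x).
Proof.
rewrite /colour; case: pickP => [z kz|none]; last by rewrite none.
rewrite (inj_eq (@Some_inj _)); case: eqVneq => [<- //|zx]; symmetry.
by apply/negbTE; rewrite (disjointFr (disB zx)).
Qed.

Let b (c : option I) := #|[set k | colour k == c]|.
Let z r x := tilt n #|A r| #|B x| (e r x).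

Let bS x : b (Some x) = #|B x|.
Proof. by apply: eq_card => k; rewrite inE colourE. Qed.

Let sum_b : (\sum_c b c = n)%N.
Proof.
rewrite /n -sum1_card (partition_big colour xpredT) //=.
by apply: eq_bigr => c _; rewrite sum1_card /b cardsE.
Qed.

(** By disjointness of the [A r], at most one factor differs from 1. The product form lets the
    weight of a permutation be regrouped into one power of [z r x] per table entry. *)
Let y (j : T) (c : option I) : R :=
  \big[Rmult/1]_r \big[Rmult/1]_(x | E r x)
    (if (j \in A r) && (c == Some x) then z r x else 1).

Let y_ge0 j c : 0 <= y j c.
Proof.
apply: Rprod_ge0 => r _; apply: Rprod_ge0 => x _.
by case: ifP => _; [exact: tilt_ge0 | lra].
Qed.

Let excess (r : I) := \big[Rplus/0]_(x | E r x) ((z r x - 1) * (INR #|B x| / INR n)).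

(** For [j] in [A r0] the sum equals [n (1 + excess r0)]: the colour classes have total size [n],
    and tilting the class [x] adds [(z r0 x - 1) #|B x|]. Outside all [A r] it is [n]. *)
Let row_sum j :
  \big[Rplus/0]_c (INR (b c) * y j c) <=
  INR n * exp (\big[Rplus/0]_(r | j \in A r) excess r).
Proof.
have n0 : INR n <> 0.
  have n_gt0 : (0 < n)%N by apply/card_gt0P; exists j.
  by have := INR_ge1 n_gt0; lra.
have [/= r0 jr0|none] := pickP [pred r | j \in A r]; last first.
  rewrite (big_pred0 _ _ _ _ none) exp_0 Rmult_1_r.
  have <- : INR (\sum_c b c) = INR n by rewrite sum_b.
  rewrite INR_sum; apply/Req_le/eq_bigr => c _.
  rewrite /y big1 ?Rmult_1_r // => r _; rewrite big1 // => x _.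
  by have /= -> := none r.
have Ar r : (j \in A r) = (r == r0).
  by case: eqVneq => [->//|rr0]; rewrite (disjointFl (disA rr0)).
rewrite (eq_bigl _ _ Ar) big_pred1_eq.
have yE c : y j c = \big[Rmult/1]_(x | E r0 x) (if c == Some x then z r0 x else 1).
  rewrite /y (bigD1 r0) //= Ar eqxx /= [X in _ * X]big1 ?Rmult_1_r // => r /negbTE r0F.
  by rewrite big1 // => x _; rewrite Ar r0F.
have yNone : y j None = 1 by rewrite yE big1.
have ySome x : y j (Some x) = if E r0 x then z r0 x else 1.
  rewrite yE; case: ifP => [Ex|nEx].
    rewrite (bigD1 x) //= eqxx big1 ?Rmult_1_r // => x' /andP[_ /negbTE x'x].
    by rewrite (inj_eq (@Some_inj _)) eq_sym x'x.
  rewrite big1 // => x' Ex'; rewrite (inj_eq (@Some_inj _)).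
  by case: eqVneq => // xx'; rewrite xx' Ex' in nEx.
have -> : \big[Rplus/0]_c (INR (b c) * y j c) = INR n * (1 + excess r0).
  rewrite big_option /= yNone Rmult_1_r.
  rewrite (eq_bigr (fun x => INR (b (Some x)) +
      if E r0 x then (z r0 x - 1) * INR #|B x| else 0)); last first.
    by move=> x _; rewrite ySome bS; case: ifP => _; ring.
  rewrite big_split /= RplusA -big_mkcond.
  rewrite -(big_option Rplus (fun c => INR (b c))) -INR_sum sum_b.
  rewrite Rmult_plus_distr_l Rmult_1_r; congr (_ + _).
  by rewrite /excess big_distrr; apply: eq_bigr => x _ /=; field.
by apply: Rmult_le_compat_l; [exact: pos_INR | exact: exp_ge1x].
Qed.

(** Markov's inequality for the tilted weights: every permutation with the table has weight [Z], so
    their number is at most the total weight divided by [Z], and the total weight is bounded by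
    [sum_perm_colour_le] and [row_sum]. *)
Lemma table_count :
  INR #|[set t : {perm T} |
          [forall r, forall x, E r x ==> (#|[set j in A r | t j \in B x]| == e r x)]]|
  <= INR n`! * (\big[Rmult/1]_x stirling_ratio #|B x|)
     * exp (- \big[Rplus/0]_r \big[Rplus/0]_(x | E r x) edge_cost n #|A r| #|B x| (e r x)).
Proof.
set S := [set t | _].
pose Z := \big[Rmult/1]_r \big[Rmult/1]_(x | E r x) pow (z r x) (e r x).
have le_n (X : {set T}) : (#|X| <= n)%N by exact: max_card.
have Z0 : 0 < Z.
  apply: Rprod_gt0 => r _; apply: Rprod_gt0 => x Ex.
  by apply: pow_tilt_gt0 => //; exact: e_le.
have lower : INR #|S| * Z <= \big[Rplus/0]_(t : {perm T}) \big[Rmult/1]_j y j (colour (t j)).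
  have <- : \big[Rplus/0]_(t in S) Z = INR #|S| * Z by rewrite Rsum_const.
  rewrite [X in X <= _]big_mkcond /=; apply: Rsum_le => t _.
  case: ifP => [|_]; last exact: Rprod_ge0.
  rewrite inE => /forallP tab; apply: Req_le; rewrite /y exchange_big /=; apply: eq_bigr => r _.
  rewrite exchange_big /=; apply: eq_bigr => x Ex.
  rewrite -big_mkcond Rprod_const /=; congr pow.
  have /forallP/(_ x)/implyP/(_ Ex)/eqP <- := tab r.
  by apply: eq_card => j; rewrite inE -colourE.
pose b_pow := \big[Rmult/1]_c pow (INR (b c)) (b c).
have b_pow0 : 0 < b_pow by apply: Rprod_gt0 => c _; exact: pow_self_gt0.
have upper := sum_perm_colour_le colour y_ge0; rewrite -/b -/b_pow in upper.
have rows : \big[Rmult/1]_j \big[Rplus/0]_c (INR (b c) * y j c) <=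
    pow (INR n) n * (exp (- \big[Rplus/0]_r \big[Rplus/0]_(x | E r x)
                             edge_cost n #|A r| #|B x| (e r x)) * Z).
  apply: Rle_trans (_ : \big[Rmult/1]_j
      (INR n * exp (\big[Rplus/0]_(r | j \in A r) excess r)) <= _).
    apply: Rprod_le => j _; split; last exact: row_sum.
    by apply: Rsum_ge0 => c _; apply: Rmult_le_pos => //; exact: pos_INR.
  rewrite big_split /= Rprod_const -exp_Rsum; apply/Req_le; congr (_ * _).
  rewrite (exchange_big_dep xpredT) //= exp_Rsum Ropp_sum exp_Rsum /Z -big_split /=.
  apply: eq_bigr => r _; rewrite Rsum_const /excess big_distrr.
  rewrite exp_Rsum Ropp_sum exp_Rsum -big_split /=.
  apply: eq_bigr => x Ex; rewrite -exp_tilt //; last exact: e_le.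
  congr exp; have -> : #|in_mem^~ (mem (A r))| = #|A r| by [].
  by rewrite /z /Rdiv; ring.
(* Each factorial is its Stirling ratio times [(m/e)^m]; the powers of [e] cancel because the class
   sizes sum to [n]. The ratio of the class [None] is absorbed by that of [n]. *)
have facts : (\big[Rmult/1]_c INR (b c)`!) * pow (INR n) n <=
    INR n`! * (\big[Rmult/1]_x stirling_ratio #|B x|) * b_pow.
  have sr c : INR (b c)`! = stirling_ratio (b c) * (exp (- INR (b c)) * pow (INR (b c)) (b c)).
    rewrite /stirling_ratio exp_Ropp; field.
    by split; [have := exp_pos (INR (b c)) | have := pow_self_gt0 (b c)]; lra.
  rewrite (eq_bigr _ (fun c _ => sr c)) big_split [X in _ * X * _ <= _]big_split /=.
  rewrite -/b_pow -exp_Rsum -Ropp_sum -INR_sum sum_b.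
  rewrite big_option /= (eq_bigr (fun x => stirling_ratio #|B x|)) => [|x _]; last by rewrite bS.
  set g := \big[_/_]_x _.
  have g0 : 0 < g by apply: Rprod_gt0 => x _; exact: stirling_ratio_gt0.
  have -> : INR n`! = stirling_ratio n * (exp (- INR n) * pow (INR n) n).
    rewrite /stirling_ratio exp_Ropp; field.
    by split; [have := exp_pos (INR n) | have := pow_self_gt0 n]; lra.
  have le_g : stirling_ratio (b None) <= stirling_ratio n.
    by apply: stirling_ratio_le; exact: le_n.
  have w0 : 0 <= g * (exp (- INR n) * pow (INR n) n * b_pow).
    apply: Rmult_le_pos; first lra; apply: Rmult_le_pos; last lra.
    by apply: Rmult_le_pos; [have := exp_pos (- INR n) | have := pow_self_gt0 n]; lra.
  have := Rmult_le_compat_r _ _ _ w0 le_g.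
  by lra.
set ex := exp _ in rows *.
have ex0 : 0 < ex by exact: exp_pos.
apply: (Rmult_le_reg_r _ _ _ (Rmult_lt_0_compat _ _ Z0 b_pow0)).
have f0 : 0 <= \big[Rmult/1]_c INR (b c)`! by apply: Rprod_ge0 => c _; exact: pos_INR.
have exZ : 0 <= ex * Z by apply: Rmult_le_pos; lra.
rewrite RmultA; apply: Rle_trans (Rmult_le_compat_r _ _ _ (Rlt_le _ _ b_pow0) lower) _.
apply: Rle_trans upper _; apply: Rle_trans (Rmult_le_compat_l _ _ _ f0 rows) _.
rewrite RmultA; apply: Rle_trans (Rmult_le_compat_r _ _ _ exZ facts) _.
by apply: Req_le; ring.
Qed.

End TableCount.

(** * The probability of finding a pattern *)

Lemma card_family_prod (aT rT : finType) (F : aT -> pred rT) :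
  (#|family F| = \prod_x #|F x|)%N.
Proof. by rewrite card_family foldrE big_map big_enum. Qed.

Lemma leq_card_bigcup (I T : finType) (P : pred I) (F : I -> {set T}) :
  (#|\bigcup_(i | P i) F i| <= \sum_(i | P i) #|F i|)%N.
Proof.
elim/big_rec2: _ => [|i m X _ le]; first by rewrite cards0.
by apply: leq_trans (leq_card_setU _ _) _; rewrite leq_add2l.
Qed.


Section FoundProbability.
Variables (h n d K : nat) (adj : rel 'I_h).
Variables (a : 'I_h -> nat -> nat) (e : 'I_h -> nat -> 'I_h -> nat -> nat).
Hypothesis d_reg : d_regular d adj.
Hypothesis e_le : forall i k i' k', gadj adj n d i k i' k' ->
  (e i k i' k' <= minn (a i k) (a i' k'))%N.

Let placement := {ffun 'I_h * 'I_K -> {set 'I_n}}.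
Let placed (A : placement) :=
  [forall v, #|A v| == a v.1 v.2] &&
  [forall i, forall k, forall k', (k != k') ==> [disjoint A (i, k) & A (i, k')]].
Let Hedge (x : 'I_h * 'I_h) := (x.1 < x.2)%N && adj x.1 x.2.
Let table (A : placement) (x : 'I_h * 'I_h) (f : {ffun 'I_n -> 'I_n}) :=
  [forall k : 'I_K, forall k' : 'I_K, wadj n h d k k' ==>
     (#|[set j in A (x.1, k) | f j \in A (x.2, k')]| == e x.1 k x.2 k')].
Let ok (A : placement) (x : 'I_h * 'I_h) : pred {ffun 'I_n -> 'I_n} :=
  [pred f : {ffun 'I_n -> 'I_n} | injectiveb f & Hedge x ==> table A x f].

Lemma lift_edge_count (s : lift_space h n) i i' (X Y : {set 'I_n}) :
  Hedge (i, i') -> nedges adj s i X i' Y = #|[set j in X | s (i, i') j \in Y]|.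
Proof.
move=> /andP[/= lt_ii' adj_ii'].
rewrite -(card_imset _ (f := fun j => (j, s (i, i') j))); last by move=> j j' [].
apply: eq_card => -[j j']; rewrite !inE /ledge adj_ii' lt_ii' /=.
apply/idP/imsetP => [/and3P[jX j'Y /eqP sj]|[j0]].
  by exists j; rewrite ?inE ?sj ?jX.
by rewrite inE => /andP[jX sY] [-> ->]; rewrite jX sY eqxx.
Qed.

(** The union bound over placements. For fixed sets, the conditions at different pairs of fibres
    concern different coordinates of the lift, so the count is a product. *)
Lemma card_found :
  (#|[set s : lift_space h n | lift_valid s && pbool (found adj d s a e)]| <=
   \sum_(A : placement | placed A) \prod_x #|ok A x|)%N.
Proof.
pose Y (A : placement) := [set s : lift_space h n | s \in family (ok A)].
apply: (@leq_trans #|\bigcup_(A | placed A) Y A|); last first.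
  apply: leq_trans (leq_card_bigcup _ _) _; apply: leq_sum => A _.
  by rewrite cardsE card_family_prod.
apply/subset_leq_card/subsetP => s; rewrite inE => /andP[/forallP s_inj].
rewrite /pbool; case: excluded_middle_informative => // -[A [cardA [disA edgeA]]] _.
apply/bigcupP; exists [ffun v : 'I_h * 'I_K => A v.1 v.2].
  apply/andP; split; first by apply/forallP => v; rewrite ffunE cardA.
  apply/forallP => i; apply/forallP => k; apply/forallP => k'; apply/implyP => kk'.
  rewrite !ffunE; apply: disA.
  by apply/eqP.
rewrite inE; apply/familyP => x; rewrite !inE s_inj; apply/implyP => Hx.
apply/forallP => k; apply/forallP => k'; apply/implyP => kk'; rewrite !ffunE /= -edgeA; last first.
  by rewrite /gadj kk' andbT; case/andP: Hx.
by rewrite lift_edge_count; case: (x) Hx.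
Qed.

Lemma card_placed : (#|placed| <= \prod_i \prod_(k < K) 'C(n, a i k))%N.
Proof.
rewrite pair_big /=.
apply: (@leq_trans #|family (fun v : 'I_h * 'I_K => [pred X : {set 'I_n} | #|X| == a v.1 v.2])|).
  apply/subset_leq_card/subsetP => A /andP[/forallP szA _].
  by apply/familyP => v; exact: szA.
rewrite card_family_prod; apply/eq_leq/eq_bigr => v _.
by rewrite -[in RHS](card_ord n) -card_draws cardsE.
Qed.

Lemma card_perm_ffun (P : pred {ffun 'I_n -> 'I_n}) :
  (#|[pred f : {ffun 'I_n -> 'I_n} | injectiveb f & P f]|
   <= #|[set t : {perm 'I_n} | P (pval t)]|)%N.
Proof.
rewrite -(card_imset _ (@val_inj _ _ _)); apply/subset_leq_card/subsetP => f /andP[f_inj Pf].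
by apply/imsetP; exists (Perm f_inj); rewrite ?inE.
Qed.

Let total_cost (x : 'I_h * 'I_h) :=
  \big[Rplus/0]_(k < K) \big[Rplus/0]_(k' < K | wadj n h d k k')
    edge_cost n (a x.1 k) (a x.2 k') (e x.1 k x.2 k').
Let factor (x : 'I_h * 'I_h) : R :=
  if Hedge x then (\big[Rmult/1]_(k < K) stirling_ratio (a x.2 k)) * exp (- total_cost x)
  else 1.

Lemma card_inj_ffun_fact : #|[pred f : {ffun 'I_n -> 'I_n} | injectiveb f]| = n`!.
Proof.
have := card_inj_ffuns 'I_n 'I_n; rewrite card_ord ffactnn => <-.
by apply: eq_card => f; rewrite !inE.
Qed.

Lemma card_ok (A : placement) x : placed A -> INR #|ok A x| <= INR n`! * factor x.
Proof.
move=> /andP[/forallP szA disA]; rewrite /factor /ok; case: ifP => Hx; last first.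
  rewrite Rmult_1_r -card_inj_ffun_fact; apply/leq_INR/subset_leq_card/subsetP => f.
  by rewrite !inE => /andP[].
have dis i (k k' : 'I_K) : k != k' -> [disjoint A (i, k) & A (i, k')].
  by move: disA => /forallP/(_ i)/forallP/(_ k)/forallP/(_ k')/implyP.
have sz i (k : 'I_K) : #|A (i, k)| = a i k by apply/eqP; exact: szA.
apply: Rle_trans (leq_INR (card_perm_ffun (table A x))) _.
rewrite /table.
have e_ok (k k' : 'I_K) : wadj n h d k k' ->
    (e x.1 k x.2 k' <= minn #|A (x.1, k)| #|A (x.2, k')|)%N.
  by move=> kk'; rewrite !sz; apply: e_le; rewrite /gadj kk' andbT; case/andP: Hx.
have := table_count (A := fun k => A (x.1, k)) (B := fun k => A (x.2, k)) (dis x.1) (dis x.2) e_ok.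
rewrite card_ord (eq_bigr (fun k : 'I_K => stirling_ratio (a x.2 k))) => [|k _]; last by rewrite sz.
rewrite RmultA; move=> le_count; apply: Rle_trans (Rle_trans _ _ _ _ le_count) _.
  by apply/leq_INR/eq_leq/eq_card => t; rewrite !inE pvalE.
apply: Req_le; congr (_ * exp (- _)); rewrite /total_cost; apply: eq_bigr => k _.
by apply: eq_bigr => k' _; rewrite !sz.
Qed.

(** Factors at least 1 allow the product to be enlarged to all ordered adjacent pairs, where each
    fibre occurs [d] times as second entry. *)
Lemma prod_Hedge_le (G : 'I_h -> R) : (forall i, 1 <= G i) ->
  \big[Rmult/1]_(x | Hedge x) G x.2 <= \big[Rmult/1]_i pow (G i) d.
Proof.
move=> G1; have [adj_sym _ deg] := d_reg.
apply: Rle_trans (_ : \big[Rmult/1]_(x : 'I_h * 'I_h | adj x.1 x.2) G x.2 <= _).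
  rewrite big_mkcond [X in _ <= X]big_mkcond; apply: Rprod_le => x _; have := G1 x.2.
  by rewrite /Hedge; case: (_ < _)%N; case: (adj _ _) => /=; lra.
rewrite -(pair_big_dep xpredT adj (fun _ i => G i)) /= (exchange_big_dep xpredT) //=.
apply/Req_le/eq_bigr => i _; rewrite Rprod_const -(deg i); congr pow.
by apply: eq_card => j; rewrite !inE adj_sym.
Qed.

(** The factor [n!] at each coordinate cancels against the number of valid lifts. The Stirling
    ratios at an edge of [H] are those of its second fibre, which gives the exponent [d]. *)
Lemma prob_found_le : (0 < n)%N ->
  prob_found n adj d a e <=
    (\big[Rmult/1]_i \big[Rmult/1]_(k < K) (INR 'C(n, a i k) * pow (stirling_ratio (a i k)) d))
    * exp (- \big[Rplus/0]_(x | Hedge x) total_cost x).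
Proof.
move=> n0; rewrite /prob_found.
have card_valid : INR #|[set s : lift_space h n | lift_valid s]| = pow (INR n`!) #|{: 'I_h * 'I_h}|.
  rewrite -Rprod_const -INR_prod; congr INR.
  rewrite -(eq_bigr _ (fun _ _ => card_inj_ffun_fact)).
  rewrite -(card_family_prod (fun _ : 'I_h * 'I_h =>
    [pred f : {ffun 'I_n -> 'I_n} | injectiveb f])).
  by apply: eq_card => s; rewrite inE; apply/forallP/familyP.
have factor_ge0 x : 0 <= factor x.
  rewrite /factor; case: ifP => _; last lra.
  apply: Rmult_le_pos; last exact/Rlt_le/exp_pos.
  by apply: Rprod_ge0 => k _; exact/Rlt_le/stirling_ratio_gt0.
have fact0 := INR_fact_gt0 n.
have pow0 : 0 < pow (INR n`!) #|{: 'I_h * 'I_h}| by exact: pow_lt.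
rewrite card_valid; apply: (Rmult_le_reg_r _ _ _ pow0).
rewrite /Rdiv -RmultA Rinv_l ?Rmult_1_r; last lra.
apply: Rle_trans (leq_INR card_found) _; rewrite INR_sum.
apply: Rle_trans (_ : \big[Rplus/0]_(A | placed A) \big[Rmult/1]_x (INR n`! * factor x) <= _).
  apply: Rsum_le => A pA; rewrite INR_prod; apply: Rprod_le => x _.
  by split; [exact: pos_INR | exact: card_ok].
rewrite Rsum_const big_split /= Rprod_const.
have factors : \big[Rmult/1]_x factor x <=
    (\big[Rmult/1]_i \big[Rmult/1]_(k < K) pow (stirling_ratio (a i k)) d)
    * exp (- \big[Rplus/0]_(x | Hedge x) total_cost x).
  rewrite /factor -big_mkcond big_split /= -exp_Rsum -Ropp_sum.
  apply: Rmult_le_compat_r; first exact/Rlt_le/exp_pos.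
  pose G i := \big[Rmult/1]_(k < K) stirling_ratio (a i k).
  have G1 i : 1 <= G i by apply: Rprod_ge1 => k _; exact: stirling_ratio_ge1.
  apply: Rle_trans (prod_Hedge_le G1) _.
  apply/Req_le/eq_bigr => i _; rewrite -[d]card_ord -Rprod_const exchange_big.
  by apply: eq_bigr => k _; rewrite Rprod_const.
rewrite (eq_bigr (fun i => (\big[Rmult/1]_(k < K) INR 'C(n, a i k)) *
   \big[Rmult/1]_(k < K) pow (stirling_ratio (a i k)) d)) => [|i _]; last by rewrite big_split.
rewrite big_split /=; set F := \big[_/_]_x factor x in factors *.
have le_placed : INR #|placed| <= \big[Rmult/1]_i \big[Rmult/1]_(k < K) INR 'C(n, a i k).
  apply: Rle_trans (leq_INR card_placed) _; rewrite INR_prod.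
  by apply/Req_le/eq_bigr => i _; rewrite INR_prod.
have F0 : 0 <= F by exact: Rprod_ge0.
have le_rest := Rmult_le_compat_l _ _ _ (Rlt_le _ _ pow0) factors.
apply: Rle_trans (Rmult_le_compat _ _ _ _ _ _ le_placed le_rest) _.
- exact: pos_INR.
- by apply: Rmult_le_pos => //; lra.
- by apply: Req_le; rewrite [pow _ _ * _]Rmult_comm !RmultA.
Qed.

End FoundProbability.

(** * Scalar inequalities *)

Lemma exp_le x y : x <= y -> exp x <= exp y.
Proof. by case=> [/exp_increasing|->]; lra. Qed.

Lemma ln_le x y : 0 < x -> x <= y -> ln x <= ln y.
Proof. by move=> x0 [/(ln_increasing _ _ x0)|->]; lra. Qed.

Lemma Rdiv_le_l x y z : 0 < y -> x <= z * y -> x / y <= z.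
Proof.
move=> y0 h; apply: (Rmult_le_reg_r _ _ _ y0).
by rewrite /Rdiv -RmultA Rinv_l ?Rmult_1_r; lra.
Qed.

(** One term of the binomial expansion of [(1 + q)^n]. *)
Lemma bin_pow_le n m q : 0 <= q -> INR 'C(n, m) * pow q m <= pow (1 + q) n.
Proof.
move=> q0; elim: n m => [|n IH] [|m]; rewrite ?bin0 ?bin0n /=; try lra.
  by have := IH 0%N; rewrite bin0 /=; nra.
rewrite binS plus_INR; have := IH m; have := IH m.+1; rewrite /=.
move: (pow (1 + q) n) (pow q m) (INR _) (INR _) => *; nra.
Qed.

(** Equivalently [exp (-t) - 1 + t <= exp t - 1 - t], so that in Fenchel's inequality one bound
    serves deviations of both signs. The derivative of the difference is
    [exp t + exp (-t) - 2 >= 0]. *)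
Lemma exp_sinh_ge t : 0 <= t -> 2 * t <= exp t - exp (- t).
Proof.
move=> t0; pose f x := exp x - exp (- x) - 2 * x.
have df x : derivable_pt_lim f x (exp x - exp (- x) * (-1) - 2 * 1).
  apply: derivable_pt_lim_minus.
    apply: derivable_pt_lim_minus; first exact: derivable_pt_lim_exp.
    apply: (derivable_pt_lim_comp Ropp exp); last exact: derivable_pt_lim_exp.
    exact: (derivable_pt_lim_opp id x 1 (derivable_pt_lim_id x)).
  by apply: derivable_pt_lim_scal; exact: derivable_pt_lim_id.
have f0 : f 0 = 0 by rewrite /f Ropp_0; lra.
case: (Req_dec t 0) => [->|tn0]; first by rewrite Ropp_0; lra.
have [||c [fc _]] := MVT_cor2 f (fun x => exp x - exp (- x) * (-1) - 2 * 1) 0 t.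
- lra.
- by move=> c _; exact: df.
suff : 0 <= exp c - exp (- c) * -1 - 2 * 1.
  rewrite f0 in fc.
  by move=> h; have := Rmult_le_pos _ _ h t0; move: fc; rewrite /f; nra.
have := exp_pos c; have := exp_pos (- c); have : exp c * exp (- c) = 1.
  by rewrite -exp_plus Rplus_opp_r exp_0.
by move: (exp c) (exp (- c)) => x y ? ? ?; have := pow2_ge_0 (x - y); nra.
Qed.

Lemma exp_quadratic_le t : 0 <= t -> exp t - 1 - t <= t ^ 2 * exp t.
Proof.
move=> t0; have := exp_ge1x (- t); have := exp_pos t; have : exp t * exp (- t) = 1.
  by rewrite -exp_plus Rplus_opp_r exp_0.
move: (exp t) (exp (- t)) => x y xy x0 y1; have h : x - 1 <= t * x by nra.
by have := Rmult_le_compat_l _ _ _ t0 h; rewrite /=; nra.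
Qed.

(* Fenchel's inequality for the Poisson rate function and its conjugate [exp t - 1 - t]. *)
Lemma rate_young mu x t : 0 < mu -> 0 <= x -> 0 <= t ->
  Rabs (x - mu) * t <= x * ln (x / mu) - x + mu + mu * (t ^ 2 * exp t).
Proof.
move=> mu0 x0 t0.
(* This is [1 + r <= exp r] at [r = s - ln (x / mu)], multiplied by [x]; it is used below at [s = t]
   and [s = -t]. *)
have le_conj s : x * s <= x * ln (x / mu) - x + mu * exp s.
  case: x0 => [x0|<-]; last by have := exp_pos s; nra.
  have xmu : 0 < x / mu by exact: Rdiv_lt_0_compat.
  have -> : mu * exp s = x * exp (s - ln (x / mu)).
    by rewrite /Rminus exp_plus exp_Ropp exp_ln //; field; lra.
  by have := exp_ge1x (s - ln (x / mu)); nra.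
have := exp_quadratic_le t0; have := exp_sinh_ge t0.
have := le_conj t; have := le_conj (- t).
by rewrite /Rabs; case: Rcase_abs => _; nra.
Qed.

(** With [q = a/n] and [m] the truncated index, [C(n,m) q^m <= (1 + q)^n <= exp a]. As [ln q <= 0]
    and [m <= a], the term [- m ln q] is at most [- a ln q]. *)
Lemma ln_bin_le n a : (0 < a)%N -> (a <= n)%N ->
  ln (INR 'C(n, minn a n./2)) <= INR a * (1 - ln (INR a / INR n)).
Proof.
move=> a0 an; have aR := INR_ge1 a0; have nR := INR_ge1 (leq_trans a0 an).
have q0 : 0 < INR a / INR n by apply: Rdiv_lt_0_compat; lra.
have q1 : INR a / INR n <= 1.
  by apply: Rdiv_le_l; [lra | rewrite Rmult_1_l; exact: leq_INR].
set m := minn _ _; set q := INR a / INR n in q0 q1 *.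
have ma : (m <= a)%N by exact: geq_minl.
have mn : (m <= n)%N by exact: leq_trans an.
have C0 : 0 < INR 'C(n, m).
  by have := INR_ge1 (_ : 0 < 'C(n, m))%N; rewrite bin_gt0 mn => /(_ isT); lra.
have le_pow : INR 'C(n, m) * pow q m <= exp (INR a).
  have -> : INR a = INR n * q by rewrite /q; field; lra.
  rewrite exp_INR; apply: Rle_trans (bin_pow_le n m (Rlt_le _ _ q0)) _.
  by apply: pow_incr; have := exp_ge1x q; lra.
have : ln (INR 'C(n, m) * pow q m) <= INR a.
  rewrite -[X in _ <= X]ln_exp; apply: ln_le => //.
  by apply: Rmult_lt_0_compat => //; exact: pow_lt.
rewrite ln_mult ?ln_pow //; last exact: pow_lt.
have lnq : ln q <= 0 by rewrite -ln_1; exact: ln_le.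
by have := leq_INR ma; nra.
Qed.

(** Substituting [q = exp (-4 x)] reduces the claim to [(1 + 4 x) exp (1/4) <= 6 exp x], which
    follows from [exp (1/4) <= 3/2] and [1 + 4 x <= 4 exp x]. *)
Lemma entropy_weight_le q : 0 < q -> q <= 1 ->
  q * (1 - ln q) * exp ((1 - ln q) / 4) <= 6 * sqrt q.
Proof.
move=> q0 q1; set x := - ln q / 4.
have lnq : ln q = - (4 * x) by rewrite /x; field.
have x0 : 0 <= x by have := ln_le q0 q1; rewrite ln_1; rewrite /x; lra.
have qE : q = exp (- x) ^ 4.
  by rewrite -exp_INR -[LHS](exp_ln q) // lnq; congr exp; rewrite /=; ring.
have -> : sqrt q = exp (- x) ^ 2.
  rewrite -[RHS]sqrt_Rsqr; last by apply: pow_le; exact/Rlt_le/exp_pos.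
  by rewrite qE /Rsqr; congr sqrt; ring.
have -> : (1 - ln q) / 4 = / 4 + x by rewrite lnq; field.
rewrite exp_plus lnq qE.
have e4 : exp (/ 4) <= 3 / 2.
  have := exp_ge1x (- / 4); have := exp_pos (/ 4); have : exp (/ 4) * exp (- / 4) = 1.
    by rewrite -exp_plus Rplus_opp_r exp_0.
  by move: (exp (/ 4)) (exp (- / 4)) => ? ?; nra.
have := exp_pos (/ 4); have := exp_ge1x x; have := exp_pos (- x); have := exp_pos x.
have : exp x * exp (- x) = 1 by rewrite -exp_plus Rplus_opp_r exp_0.
move: (exp x) (exp (- x)) (exp (/ 4)) e4 => u v w w32 uv u0 v0 ux w0.
have -> : v ^ 4 * (1 - - (4 * x)) * (w * u) = v ^ 2 * (v * (u * v) * ((1 + 4 * x) * w)) by ring.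
rewrite uv Rmult_1_r [6 * _]Rmult_comm; apply: Rmult_le_compat_l; first exact: pow2_ge_0.
have -> : 6 = v * (6 * u) by lra.
by apply: Rmult_le_compat_l; nra.
Qed.

(* The last factor is a telescoping difference along the scales [w, 2 w, 4 w, ...]. *)
Lemma scale_weight_le w rho s : 0 < w -> 0 < rho -> 0 <= s -> s <= 1 -> s * w <= rho ->
  s * (w / (w + rho)) <= 3 * (2 * w / (2 * w + rho) - w / (w + rho)).
Proof.
move=> w0 r0 s0 s1 sw.
have -> : 2 * w / (2 * w + rho) - w / (w + rho) = w / (w + rho) * (rho / (2 * w + rho)).
  by field; lra.
have le_s : s <= 3 * (rho / (2 * w + rho)).
  apply: (Rmult_le_reg_r (2 * w + rho)); first lra.
  have -> : 3 * (rho / (2 * w + rho)) * (2 * w + rho) = 3 * rho by field; lra.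
  by nra.
have : 0 < w / (w + rho) by apply: Rdiv_lt_0_compat; lra.
by nra.
Qed.

(** Pascal's rule twice: [C(n+2,m+1)] is at least [C(n,m) + C(n+1,m)]. *)
Lemma exp2_le_bin m n : (m.*2 <= n)%N -> (2 ^ m <= 'C(n, m))%N.
Proof.
elim: m n => [|m IH] [|[|n]] //=; rewrite ?bin0 // doubleS !ltnS => le_mn.
rewrite expnS mul2n -addnn !binS -addnA; apply: leq_trans (leq_addl _ _).
apply: leq_add; first exact: IH.
by apply: leq_trans (IH _ le_mn) _; exact: leq_bin2l.
Qed.

(** For [c = ln 2 / (d+1)], the bound [(m+1) c <= exp ((m+1) c)] raised to the power [d] gives
    [((m+1) c)^d <= 2^(m+1)], hence the constant [2 / c^d]. *)
Lemma pow_le_exp2 d : exists C, forall m, pow (INR m + 1) d <= C * pow 2 m.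
Proof.
have ln2 : 0 < ln 2 by rewrite -ln_1; apply: ln_increasing; lra.
have d0 : 0 < INR d + 1 by have := pos_INR d; lra.
pose c := ln 2 / (INR d + 1).
have c0 : 0 < c by exact: Rdiv_lt_0_compat.
exists (2 * / pow c d) => m; have cd0 : 0 < pow c d by exact: pow_lt.
apply: (Rmult_le_reg_r _ _ _ cd0); rewrite -Rpow_mult_distr.
have -> : 2 * / pow c d * pow 2 m * pow c d = pow 2 m.+1 by rewrite /=; field; lra.
have m0 := pos_INR m.
apply: Rle_trans (pow_incr _ (exp ((INR m + 1) * c)) d _) _.
  by split; [nra | have := exp_ge1x ((INR m + 1) * c); lra].
have -> : 2 = exp (ln 2) by rewrite exp_ln; lra.
rewrite -!exp_INR S_INR; apply: exp_le.
have dc : INR d * c <= ln 2.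
  have -> : ln 2 = (INR d + 1) * c by rewrite /c; field; lra.
  nra.
nra.
Qed.

(** The polynomial factors are absorbed by the entropy: with [m = min(a, n/2)], the ratio is at most
    [2 e (m+1)], while the binomial is at least [2^m]. Taking [C >= 1] allows powers of [C] to be
    enlarged later. *)
Lemma stirling_ratio_pow_le d : exists2 C, 1 <= C &
  forall n a, (a <= n)%N -> pow (stirling_ratio a) d <= C * INR 'C(n, minn a n./2).
Proof.
have [C0 le_C0] := pow_le_exp2 d; exists (Rmax 1 (pow (2 * exp 1) d * C0)); first exact: Rmax_l.
move=> n a an; set m := minn a n./2.
(* The extra 1 accounts for odd [n]. *)
have am : (a <= m.*2.+1)%N.
  rewrite /m /minn; case: ltnP => _; first by rewrite -addnn leqW // leq_addr.
  by rewrite (leq_trans an) // -{1}(odd_double_half n) -add1n leq_add2r; case: odd.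
have mn : (m.*2 <= n)%N.
  by rewrite -[n in (_ <= n)%N]odd_double_half (leq_trans _ (leq_addl _ _)) // leq_double geq_minr.
have e0 := exp_pos 1.
apply: Rle_trans (_ : pow (2 * exp 1 * (INR m + 1)) d <= _).
  apply: pow_incr; split; first exact/Rlt_le/stirling_ratio_gt0.
  apply: Rle_trans (stirling_ratio_linear _) _.
  by have := leq_INR am; rewrite S_INR -addnn plus_INR; have := pos_INR m; nra.
rewrite Rpow_mult_distr; have p0 : 0 < pow (2 * exp 1) d by apply: pow_lt; lra.
apply: Rle_trans (Rmult_le_compat_l _ _ _ (Rlt_le _ _ p0) (le_C0 m)) _; rewrite RmultA.
have two_m : pow 2 m <= INR 'C(n, m).
  have -> : pow 2 m = INR (2 ^ m) by elim: (m) => [|k IH] //; rewrite expnS mult_INR -IH /=; ring.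
  exact/leq_INR/exp2_le_bin.
have two_pos : 0 < pow 2 m by apply: pow_lt; lra.
apply: Rle_trans (Rmult_le_compat_r _ _ _ (Rlt_le _ _ two_pos) (Rmax_r 1 _)) _.
by apply: Rmult_le_compat_l => //; have := Rmax_l 1 (pow (2 * exp 1) d * C0); lra.
Qed.

(** Binomials increase up to [n/2]; an index beyond it is reflected to [n - m]. *)
Lemma bin_le_half n m : (m <= n)%N -> ('C(n, m) <= 'C(n, minn m n./2))%N.
Proof.
have step k : (k.*2 < n)%N -> ('C(n, k) <= 'C(n, k.+1))%N.
  move=> kn; have kk : (k + k.+1 <= n)%N by rewrite addnS addnn.
  rewrite -(leq_pmul2l (ltn0Sn k)) mul_bin_left leq_mul2r orbC.
  by rewrite leq_subRL ?kk // (leq_trans _ kk) // leq_addr.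
have mono j k : (j <= k)%N -> (k <= n./2)%N -> ('C(n, j) <= 'C(n, k))%N.
  move=> /subnK <-; elim: (k - j)%N => // i IH; rewrite addSn => ik.
  apply: leq_trans (IH (ltnW ik)) (step _ _).
  by move: ik; rewrite gtn_half_double; exact: ltnW.
move=> mn; have [le_m|half_m] := leqP m n./2; first by rewrite leqnn.
rewrite -bin_sub //; apply: mono => //.
rewrite leq_subLR -{1}(odd_double_half n) -addnn addnA leq_add2r.
by apply: leq_trans half_m; rewrite -add1n leq_add2r; case: odd.
Qed.

(* Delete vertices violating the first conclusion, one at a time. *)
Lemma prune (T : finType) (c g : T -> T -> R) (q B : T -> R) :
  (forall v, 0 <= B v) -> (forall v u, g v u = g u v) -> (forall v, g v v = 0) ->
  (forall (S : {set T}) v, \big[Rplus/0]_(u in S) c v u < q v ->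
     \big[Rplus/0]_(u in S) g v u <= B v) ->
  exists2 S : {set T}, (forall v, v \in S -> q v <= \big[Rplus/0]_(u in S) c v u) &
    \big[Rplus/0]_v \big[Rplus/0]_u g v u <=
    \big[Rplus/0]_(v in S) \big[Rplus/0]_(u in S) g v u + 2 * \big[Rplus/0]_v B v.
Proof.
move=> B0 g_sym g_diag bound.
suff loop m (X : {set T}) : (#|X| <= m)%N ->
    exists2 S : {set T}, (forall v, v \in S -> q v <= \big[Rplus/0]_(u in S) c v u) &
      \big[Rplus/0]_(v in X) \big[Rplus/0]_(u in X) g v u <=
      \big[Rplus/0]_(v in S) \big[Rplus/0]_(u in S) g v u + 2 * \big[Rplus/0]_(v in X) B v.
  have [S S_ok le_S] := loop _ _ (leqnn #|[set: T]|); exists S => //.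
  rewrite (eq_bigl (mem [set: T])) => [|v]; last by rewrite !inE.
  rewrite [X in _ <= _ + 2 * X](eq_bigl (mem [set: T])) => [|v]; last by rewrite !inE.
  apply: Rle_trans le_S; apply/Req_le/eq_bigr => v _; apply: eq_bigl => u.
  by rewrite !inE.
elim: m X => [|m IH] X cardX.
  exists set0 => [v|]; first by rewrite inE.
  by move: cardX; rewrite leqn0 cards_eq0 => /eqP ->; rewrite !big_set0; lra.
have [[v [vX small]]|ok] := excluded_middle_informative
    (exists v, v \in X /\ \big[Rplus/0]_(u in X) c v u < q v); last first.
  exists X => [v vX|]; first by apply: Rnot_lt_le => small; apply: ok; exists v.
  have : 0 <= \big[Rplus/0]_(v in X) B v by exact: Rsum_ge0.
  by lra.
have [|S S_ok le_S] := IH (X :\ v).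
  by move: cardX; rewrite (cardsD1 v) vX.
exists S => //.
have split_row F : \big[Rplus/0]_(u in X) F u = F v + \big[Rplus/0]_(u in X :\ v) F u.
  exact: big_setD1.
(* Deleting [v] removes both its row and its column, equal by symmetry; this is the source of the
   factor 2 before the budgets. *)
have -> : \big[Rplus/0]_(u in X) \big[Rplus/0]_(w in X) g u w =
    2 * \big[Rplus/0]_(u in X) g v u +
    \big[Rplus/0]_(u in X :\ v) \big[Rplus/0]_(w in X :\ v) g u w.
  have inner : \big[Rplus/0]_(u in X :\ v) \big[Rplus/0]_(w in X) g u w =
      \big[Rplus/0]_(u in X :\ v) g v u +
      \big[Rplus/0]_(u in X :\ v) \big[Rplus/0]_(w in X :\ v) g u w.
    by rewrite -big_split; apply: eq_bigr => u _; rewrite split_row g_sym.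
  rewrite (split_row (fun u => \big[Rplus/0]_(w in X) g u w)) inner.
  by rewrite (split_row (g v)) g_diag; ring.
by have := bound X v small; rewrite (split_row B); lra.
Qed.

(** * Pruning a pattern *)

Lemma wt_gt0 n h k : (0 < n)%N -> (0 < h)%N -> 0 < wt n h k.
Proof.
move=> n0 h0; apply: Rdiv_lt_0_compat; first by apply: pow_lt; lra.
by apply: sqrt_lt_R0; apply: Rmult_lt_0_compat; have := INR_ge1 n0; have := INR_ge1 h0; lra.
Qed.

Lemma wtS n h k : wt n h k.+1 = 2 * wt n h k.
Proof. by rewrite /wt /= /Rdiv; ring. Qed.

Lemma RltbP x y : reflect (x < y) (Rltb x y).
Proof. by rewrite /Rltb; case: Rlt_dec => ?; constructor. Qed.

Lemma wadjP n h d k k' : (0 < n)%N -> (0 < h)%N -> (0 < d)%N ->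
  reflect (wt n h k < sqrt (INR d) * wt n h k' /\ wt n h k' < sqrt (INR d) * wt n h k)
    (wadj n h d k k').
Proof.
move=> n0 h0 d0; have w0 := wt_gt0 k n0 h0; have w'0 := wt_gt0 k' n0 h0.
have s0 : 0 < sqrt (INR d) by apply: sqrt_lt_R0; have := INR_ge1 d0; lra.
have eq1 : wt n h k = wt n h k / wt n h k' * wt n h k' by field; lra.
have eq2 : wt n h k' = / sqrt (INR d) * (sqrt (INR d) * wt n h k') by field; lra.
apply: (iffP andP) => [[/RltbP lo /RltbP hi]|[hi lo]].
  split; first by rewrite eq1; apply: Rmult_lt_compat_r.
  have := Rmult_lt_compat_r _ _ _ (Rmult_lt_0_compat _ _ s0 w'0) lo.
  by rewrite -eq2; have -> : wt n h k / wt n h k' * (sqrt (INR d) * wt n h k') =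
    sqrt (INR d) * wt n h k by field; lra.
split; apply/RltbP; apply: (Rmult_lt_reg_r _ _ _ w'0); rewrite -eq1 //.
apply: (Rmult_lt_reg_l _ _ _ s0).
by have -> : sqrt (INR d) * (/ sqrt (INR d) * wt n h k') = wt n h k' by field; lra.
Qed.

Lemma wadj_sym n h d k k' : (0 < n)%N -> (0 < h)%N -> (0 < d)%N ->
  wadj n h d k k' = wadj n h d k' k.
Proof. by move=> n0 h0 d0; apply/(wadjP _ _ n0 h0 d0)/(wadjP _ _ n0 h0 d0) => -[]. Qed.

Section Removal.
#[local] Arguments pow : simpl never.
Variables (h n d k0 : nat) (adj : rel 'I_h).
Variables (a : 'I_h -> nat -> nat) (e : 'I_h -> nat -> 'I_h -> nat -> nat).
Hypothesis d0 : (0 < d)%N.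
Hypothesis d_reg : d_regular d adj.
Hypothesis n0 : (0 < n)%N.
Hypothesis pat : is_pattern adj n d a e k0.
Let K := Kbound d k0.
Let V := ('I_h * 'I_K)%type.
Implicit Types (v u : V) (i : 'I_h).

Let w v : R := wt n h v.2.
Let A v : R := INR (a v.1 v.2).
Let mu v u : R := A v * A u / INR n.
Let s_d : R := sqrt (INR d).

Definition vcost v u : R :=
  if gadj adj n d v.1 v.2 u.1 u.2
  then edge_cost n (a v.1 v.2) (a u.1 u.2) (e v.1 v.2 u.1 u.2) else 0.
Definition vterm v u : R :=
  if gadj adj n d v.1 v.2 u.1 u.2 then pterm n a e v.1 v.2 u.1 u.2 else 0.
Definition vbin v : R := ln (INR 'C(n, minn (a v.1 v.2) n./2)).

Let mass i : R := \big[Rplus/0]_(k < K) (wt n h k ^ 2 * INR (a i k)).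
Let rho i : R := sqrt (mass i / INR n).
(** A function of the weight with values in [[0, 1]]. Its increments [gap] over successive scales
    telescope, so they sum to at most 1 on each fibre. *)
Let scale i x : R := x / (x + rho i).
Let gap v : R := scale v.1 (wt n h v.2.+1) - scale v.1 (w v).
Let nbr_mass i : R := \big[Rplus/0]_(i' | adj i i') mass i'.

Let h0 i : (0 < h)%N. Proof. exact: leq_ltn_trans (leq0n i) (ltn_ord i). Qed.
Let w_gt0 v : 0 < w v. Proof. exact: wt_gt0 (h0 v.1). Qed.
Let nR : 1 <= INR n. Proof. exact: INR_ge1. Qed.
Let sd_gt0 : 0 < s_d. Proof. by apply: sqrt_lt_R0; have := INR_ge1 d0; lra. Qed.
Let sd2 : s_d * s_d = INR d. Proof. by apply: sqrt_sqrt; exact: pos_INR. Qed.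
Let A_ge0 v : 0 <= A v. Proof. exact: pos_INR. Qed.

Let mass_ge0 i : 0 <= mass i.
Proof. by apply: Rsum_ge0 => k _; apply: Rmult_le_pos; [exact: pow2_ge_0 | exact: pos_INR]. Qed.

Let mass_ge v : w v ^ 2 * A v <= mass v.1.
Proof.
rewrite /mass (bigD1 v.2) //=.
set r := \big[_/_]_(_ | _) _; suff : 0 <= r by rewrite /w /A; lra.
by apply: Rsum_ge0 => k _; apply: Rmult_le_pos; [exact: pow2_ge_0 | exact: pos_INR].
Qed.

Lemma pattern_le_n v : (a v.1 v.2 <= n)%N.
Proof. by apply: leq_trans (pat.2.1 v.1); rewrite (bigD1 v.2) //= leq_addr. Qed.

Let rho_ge0 i : 0 <= rho i. Proof. exact: sqrt_pos. Qed.
Let rho2 i : rho i * rho i = mass i / INR n.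
Proof.
apply: sqrt_sqrt; apply: Rmult_le_pos => //.
by apply/Rlt_le/Rinv_0_lt_compat; lra.
Qed.

Let scale_bounds i x : 0 < x -> 0 <= scale i x <= 1.
Proof.
move=> x0; have r0 := rho_ge0 i; split.
  by apply: Rmult_le_pos; [lra | apply/Rlt_le/Rinv_0_lt_compat; lra].
by apply: Rdiv_le_l; lra.
Qed.

Let gap_ge0 v : 0 <= gap v.
Proof.
have r0 := rho_ge0 v.1; have w0 := w_gt0 v.
have -> : gap v = w v * rho v.1 / ((2 * w v + rho v.1) * (w v + rho v.1)).
  by rewrite /gap /scale wtS -/(w v); field; lra.
apply: Rmult_le_pos; first by apply: Rmult_le_pos; lra.
by apply/Rlt_le/Rinv_0_lt_compat; apply: Rmult_lt_0_compat; lra.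
Qed.

(** Fenchel's inequality at [t = w v * w u / lam], multiplied by [lam]. The first summand pays with
    the cost of the edge; the second bounds [lam * mu * t^2 * exp t]. *)
Let edge_bound v u : (0 < a v.1 v.2)%N ->
  Rabs (vterm v u) <=
  4 * s_d * (w v * (w v + rho v.1)) / (1 - ln (A v / INR n)) * vcost v u +
  (if gadj adj n d v.1 v.2 u.1 u.2 then 9 / 2 / s_d * gap v * (w u ^ 2 * A u) else 0).
Proof.
move=> av0; rewrite /vterm /vcost; case: ifP => [vu|_]; last by rewrite Rabs_R0; lra.
have av1 : 1 <= A v by exact: INR_ge1.
have w0 := w_gt0 v; have wu0 := w_gt0 u; have n_pos : 0 < INR n by lra.
set q := A v / INR n; set T := 1 - ln q.
have q0 : 0 < q by apply: Rdiv_lt_0_compat; lra.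
have q1 : q <= 1 by apply: Rdiv_le_l => //; rewrite Rmult_1_l; apply: leq_INR; exact: pattern_le_n.
have T1 : 1 <= T by have := ln_le q0 q1; rewrite ln_1 /T; lra.
have rest_ge0 : 0 <= 9 / 2 / s_d * gap v * (w u ^ 2 * A u).
  apply: Rmult_le_pos; last by apply: Rmult_le_pos => //; exact: pow2_ge_0.
  apply: Rmult_le_pos => //; apply: Rmult_le_pos; first lra.
  by apply/Rlt_le/Rinv_0_lt_compat.
have e_le := (pat.2.2.2 _ _ _ _ vu).2.
(* Here [mu = 0], which [rate_young] excludes; but [e = 0] as well and the term vanishes. *)
have [au0|au0] := posnP (a u.1 u.2).
  have e0 : e v.1 v.2 u.1 u.2 = 0%N by move: e_le; rewrite au0 minn0 leqn0 => /eqP.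
  rewrite /pterm /edge_cost e0 au0 /= Rmult_0_r /Rdiv !Rmult_0_l !Rminus_0_r Rplus_0_r.
  by rewrite Rmult_0_r Rmult_0_r Rabs_R0; lra.
have au1 : 1 <= A u by exact: INR_ge1.
have rho_gt0 : 0 < rho v.1.
  apply: sqrt_lt_R0; apply: Rdiv_lt_0_compat => //; apply: Rlt_le_trans (mass_ge v).
  by apply: Rmult_lt_0_compat; [apply: pow_lt | lra].
have w_u : w u <= s_d * w v.
  apply: Rlt_le; case/andP: vu => _ /(wadjP _ _ n0 (h0 v.1) d0)[].
  by rewrite -/(w v) -/(w u).
set lam := 4 * s_d * (w v * (w v + rho v.1)) / T.
have lam0 : 0 < lam.
  apply: Rdiv_lt_0_compat; last lra; apply: Rmult_lt_0_compat; first lra.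
  by apply: Rmult_lt_0_compat; lra.
pose t := w v * w u / lam.
have tE : t = w u * T / (4 * s_d * (w v + rho v.1)) by rewrite /t /lam; field; lra.
have t0 : 0 <= t by apply/Rlt_le/Rdiv_lt_0_compat => //; exact: Rmult_lt_0_compat.
(* The weight ratio on an edge of [Gamma] is below [sqrt d]; the constant 4 in [lam] yields the
   exponent of [entropy_weight_le]. *)
have tT : t <= T / 4.
  rewrite tE; apply: Rdiv_le_l; first by apply: Rmult_lt_0_compat; lra.
  have -> : T / 4 * (4 * s_d * (w v + rho v.1)) = (s_d * w v + s_d * rho v.1) * T by field.
  by apply: Rmult_le_compat_r; nra.
have mu0 : 0 < mu v u by apply: Rdiv_lt_0_compat => //; nra.
have young := rate_young mu0 (pos_INR (e v.1 v.2 u.1 u.2)) t0.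
have abs_term : Rabs (pterm n a e v.1 v.2 u.1 u.2) =
    lam * (Rabs (INR (e v.1 v.2 u.1 u.2) - mu v u) * t).
  rewrite /pterm Rabs_mult -/(A v) -/(A u) -/(mu v u) -/(w v) -/(w u).
  rewrite (Rabs_pos_eq (w v * w u)); last by apply: Rmult_le_pos; lra.
  by rewrite /t; field; lra.
rewrite abs_term; apply: Rle_trans (Rmult_le_compat_l _ _ _ (Rlt_le _ _ lam0) young) _.
rewrite Rmult_plus_distr_l /edge_cost -/(A v) -/(A u) -/(mu v u).
apply: Rplus_le_compat_l.
have -> : lam * (mu v u * (t ^ 2 * exp t)) =
    (w u ^ 2 * A u) * (/ (4 * s_d)) * (w v / (w v + rho v.1)) * (q * T * exp t).
  rewrite (_ : lam * (mu v u * (t ^ 2 * exp t)) = (lam * t) * (mu v u * (t * exp t))); last by ring.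
  have -> : lam * t = w v * w u by rewrite /t; field; lra.
  by rewrite tE /mu /q; field; lra.
have qT : q * T * exp t <= 6 * sqrt q.
  apply: Rle_trans (entropy_weight_le q0 q1); rewrite -/T.
  by apply: Rmult_le_compat_l; [nra | exact: exp_le].
(* The condition [sqrt q * w v <= rho] holds because [w v ^ 2 * A v] is one term of the mass of the
   fibre. *)
have le_gap : sqrt q * (w v / (w v + rho v.1)) <= 3 * gap v.
  rewrite /gap /scale wtS -/(w v); apply: scale_weight_le => //.
  - exact: sqrt_pos.
  - by rewrite -sqrt_1; apply: sqrt_le_1_alt.
  rewrite -(sqrt_square (w v)); last lra.
  rewrite -sqrt_mult_alt; last lra.
  apply: sqrt_le_1_alt; rewrite /q.
  have -> : A v / INR n * (w v * w v) = (w v ^ 2 * A v) / INR n by field; lra.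
  apply: Rmult_le_compat_r => //.
  by apply/Rlt_le/Rinv_0_lt_compat.
set X := w u ^ 2 * A u * / (4 * s_d).
have X0 : 0 <= X.
  apply: Rmult_le_pos; first by apply: Rmult_le_pos => //; exact: pow2_ge_0.
  by apply/Rlt_le/Rinv_0_lt_compat; lra.
have wr0 : 0 < w v / (w v + rho v.1) by apply: Rdiv_lt_0_compat; lra.
(* The constant is [6 * 3 / 4], from [entropy_weight_le], [scale_weight_le] and [lam]. *)
have -> : 9 / 2 / s_d * gap v * (w u ^ 2 * A u) = X * (18 * gap v) by rewrite /X; field; lra.
rewrite -RmultA; apply: Rmult_le_compat_l => //.
by have := Rmult_le_compat_l _ _ _ (Rlt_le _ _ wr0) qT; lra.
Qed.

Lemma vcost_eq0 v u : a v.1 v.2 = 0%N -> vcost v u = 0.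
Proof.
move=> av0; rewrite /vcost; case: ifP => // vu; have := (pat.2.2.2 _ _ _ _ vu).2.
rewrite av0 min0n leqn0 => /eqP ->.
by rewrite /edge_cost /= /Rdiv !Rmult_0_l; ring.
Qed.

Lemma gadj_sym v u : gadj adj n d v.1 v.2 u.1 u.2 = gadj adj n d u.1 u.2 v.1 v.2.
Proof. by have [adj_sym _ _] := d_reg; rewrite /gadj adj_sym (wadj_sym _ _ n0 (h0 v.1) d0). Qed.

Lemma vterm_sym v u : vterm v u = vterm u v.
Proof.
rewrite /vterm gadj_sym; case: ifP => // uv.
by rewrite /pterm (pat.2.2.2 _ _ _ _ uv).1 /Rdiv; ring.
Qed.

Lemma vcost_sym v u : vcost v u = vcost u v.
Proof.
rewrite /vcost gadj_sym; case: ifP => // uv.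
by rewrite (pat.2.2.2 _ _ _ _ uv).1 /edge_cost (Rmult_comm (INR (a v.1 v.2))).
Qed.

(** The first part is [lam] times [L / 2 * A v * T], in which [T] cancels; the second sums the
    remainders of [edge_bound] over neighbouring fibres. *)
Let budget (L : R) v : R :=
  2 * L * s_d * (w v ^ 2 * A v + w v * A v * rho v.1) + 9 / 2 / s_d * gap v * nbr_mass v.1.

Let nbr_mass_ge0 i : 0 <= nbr_mass i. Proof. exact: Rsum_ge0. Qed.

Let budget_ge0 L v : 0 <= L -> 0 <= budget L v.
Proof.
move=> L0; have w0 := w_gt0 v; apply: Rplus_le_le_0_compat.
  apply: Rmult_le_pos; first by apply: Rmult_le_pos; lra.
  apply: Rplus_le_le_0_compat; first by apply: Rmult_le_pos => //; exact: pow2_ge_0.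
  by apply: Rmult_le_pos => //; apply: Rmult_le_pos => //; lra.
apply: Rmult_le_pos => //; apply: Rmult_le_pos => //; apply: Rmult_le_pos; first lra.
exact/Rlt_le/Rinv_0_lt_compat.
Qed.

Let row_bound L (S : {set V}) v : 0 <= L ->
  \big[Rplus/0]_(u in S) vcost v u < L / 2 * vbin v ->
  \big[Rplus/0]_(u in S) Rabs (vterm v u) <= budget L v.
Proof.
move=> L0; have [av0|av0] := posnP (a v.1 v.2).
  rewrite big1 => [|u _]; last exact: vcost_eq0.
  by rewrite /vbin av0 min0n bin0 ln_1; lra.
move=> small; have w0 := w_gt0 v; have r0 := rho_ge0 v.1.
have av1 : 1 <= A v by exact: INR_ge1.
have q0 : 0 < A v / INR n by apply: Rdiv_lt_0_compat; lra.
have q1 : A v / INR n <= 1.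
  by apply: Rdiv_le_l; [lra | rewrite Rmult_1_l; apply: leq_INR; exact: pattern_le_n].
apply: Rle_trans; first by apply: Rsum_le => u _; exact: edge_bound.
rewrite big_split /= -big_distrr /=.
have T1 : 1 <= 1 - ln (A v / INR n) by have := ln_le q0 q1; rewrite ln_1; lra.
have vbin_le : vbin v <= A v * (1 - ln (A v / INR n)).
  exact: ln_bin_le av0 (pattern_le_n v).
set T := 1 - _ in T1 vbin_le *; apply: Rplus_le_compat.
  set lam := _ / T; have lam0 : 0 <= lam.
    apply/Rlt_le/Rdiv_lt_0_compat; last lra; apply: Rmult_lt_0_compat; first lra.
    by apply: Rmult_lt_0_compat; lra.
  apply: Rle_trans (_ : lam * (L / 2 * (A v * T)) <= _).
    apply: Rmult_le_compat_l => //; apply: Rle_trans (Rlt_le _ _ small) _.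
    by apply: Rmult_le_compat_l => //; lra.
  by apply: Req_le; rewrite /lam; field; lra.
rewrite -big_mkcondr -big_distrr /=; apply: Rmult_le_compat_l.
  apply: Rmult_le_pos => //; apply: Rmult_le_pos; first lra.
  exact/Rlt_le/Rinv_0_lt_compat.
rewrite /nbr_mass /mass pair_big_dep big_mkcond [X in _ <= X]big_mkcond /=.
apply: Rsum_le => u _; rewrite /gadj andbT.
have u0 : 0 <= w u ^ 2 * A u by apply: Rmult_le_pos => //; exact: pow2_ge_0.
by case: (adj _ _) => /=; rewrite ?andbF //; try lra; case: ifP => _; rewrite -/(w u) -/(A u); lra.
Qed.

Let sum_budget L : 20 <= L -> \big[Rplus/0]_v budget L v <= 55 * L * s_d.
Proof.
move=> L20; have [_ [sum_a [sum_mass _]]] := pat.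
have mass10 : \big[Rplus/0]_i mass i <= 10 by exact: sum_mass.
rewrite /budget big_split /= -big_distrr /=.
(* By [w rho <= (w^2 + rho^2) / 2] and [rho^2 n = mass], each fibre contributes at most twice its
   mass, and the masses sum to at most 10. *)
have first_part : \big[Rplus/0]_v (w v ^ 2 * A v + w v * A v * rho v.1) <= 20.
  rewrite -(pair_bigA _ (fun i (k : 'I_K) =>
    w (i, k) ^ 2 * A (i, k) + w (i, k) * A (i, k) * rho i)) /=.
  apply: Rle_trans (_ : 2 * \big[Rplus/0]_i mass i <= _); last lra.
  rewrite big_distrr; apply: Rsum_le => i _ /=.
  have sum_A : \big[Rplus/0]_(k < K) A (i, k) <= INR n.
    by rewrite -INR_sum; apply: leq_INR; exact: sum_a.
  apply: Rle_trans (_ : \big[Rplus/0]_(k < K)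
      (3 / 2 * (w (i, k) ^ 2 * A (i, k)) + rho i * rho i / 2 * A (i, k)) <= _).
    apply: Rsum_le => k _; have := A_ge0 (i, k); have := pow2_ge_0 (w (i, k) - rho i).
    by nra.
  rewrite big_split /= -!big_distrr /= -/(mass i).
  have : rho i * rho i / 2 * \big[Rplus/0]_(k < K) A (i, k) <= rho i * rho i / 2 * INR n.
    by apply: Rmult_le_compat_l => //; have := rho_ge0 i; nra.
  rewrite rho2; have -> : mass i / INR n / 2 * INR n = mass i / 2 by field; lra.
  by move=> le_A; apply: Rle_trans (Rplus_le_compat_l _ _ _ le_A) _; lra.
(* The gaps of a fibre sum to at most 1, and each mass is counted by [d] neighbours, giving
   [9/2 / sqrt d * d * 10]. *)
have second_part : \big[Rplus/0]_v (9 / 2 / s_d * gap v * nbr_mass v.1) <= 45 * s_d.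
  rewrite -(pair_bigA _ (fun i (k : 'I_K) => 9 / 2 / s_d * gap (i, k) * nbr_mass i)) /=.
  apply: Rle_trans (_ : \big[Rplus/0]_i (9 / 2 / s_d * nbr_mass i) <= _).
    apply: Rsum_le => i _.
    rewrite (eq_bigr (fun k => 9 / 2 / s_d * nbr_mass i * gap (i, k))) => [|k _]; last by ring.
    rewrite -big_distrr /= -[X in _ <= X]Rmult_1_r; apply: Rmult_le_compat_l.
      apply: Rmult_le_pos => //; apply: Rmult_le_pos; first lra.
      exact/Rlt_le/Rinv_0_lt_compat.
    have telescope m : \big[Rplus/0]_(k < m) (scale i (wt n h k.+1) - scale i (wt n h k)) =
        scale i (wt n h m) - scale i (wt n h 0).
      by elim: m => [|m IH]; rewrite ?big_ord0 ?big_ord_recr /= ?IH; ring.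
    rewrite /gap telescope.
    have := scale_bounds i (wt_gt0 K n0 (h0 i)); have := scale_bounds i (wt_gt0 0 n0 (h0 i)).
    by lra.
  rewrite -big_distrr /=.
  have -> : \big[Rplus/0]_i nbr_mass i = INR d * \big[Rplus/0]_i mass i.
    have [adj_sym _ deg] := d_reg.
    rewrite /nbr_mass (exchange_big_dep xpredT) //= big_distrr /=; apply: eq_bigr => i _.
    rewrite Rsum_const -(deg i); congr (INR _ * _).
    by apply: eq_card => j; rewrite !inE adj_sym.
  rewrite -sd2; have -> : 9 / 2 / s_d * (s_d * s_d * \big[Rplus/0]_i mass i) =
    9 / 2 * s_d * \big[Rplus/0]_i mass i by field; lra.
  by nra.
have coef : 0 <= 2 * L * s_d by apply: Rmult_le_pos; lra.
(* The two parts are [40 L sqrt d] and [45 sqrt d], and [45 <= 15 L]. *)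
apply: Rle_trans (Rplus_le_compat _ _ _ _ (Rmult_le_compat_l _ _ _ coef first_part) second_part) _.
by nra.
Qed.

Lemma pattern_prune L : 20 <= L ->
  exists2 S : {set V},
    (forall v, v \in S -> L / 2 * vbin v <= \big[Rplus/0]_(u in S) vcost v u) &
    \big[Rplus/0]_v \big[Rplus/0]_u Rabs (vterm v u) <=
    \big[Rplus/0]_(v in S) \big[Rplus/0]_(u in S) Rabs (vterm v u) + 2 * (55 * L * s_d).
Proof.
move=> L20; have [_ irr _] := d_reg.
have [||||S S_ok le_S] := @prune V vcost (fun v u => Rabs (vterm v u))
  (fun v => L / 2 * vbin v) (budget L).
- by move=> v; apply: budget_ge0; lra.
- by move=> v u; rewrite vterm_sym.
- by move=> v; rewrite /vterm /gadj irr Rabs_R0.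
- by move=> S v; apply: row_bound; lra.
exists S => //; apply: Rle_trans le_S _.
by apply: Rplus_le_compat_l; apply: Rmult_le_compat_l (sum_budget L20); lra.
Qed.

End Removal.

(** * From the surviving vertex set to potency and probability *)

Lemma sum_ordered_pairs h (T : finType) (f : 'I_h * T -> 'I_h * T -> R) :
  (forall v u, f v u = f u v) -> (forall v u, v.1 = u.1 -> f v u = 0) ->
  \big[Rplus/0]_v \big[Rplus/0]_u f v u =
  2 * \big[Rplus/0]_(p : ('I_h * T) * ('I_h * T) | (p.1.1 < p.2.1)%N) f p.1 p.2.
Proof.
move=> f_sym f_diag; rewrite pair_big /=.
rewrite (bigID (fun p : ('I_h * T) * ('I_h * T) => (p.1.1 < p.2.1)%N)) /=.
rewrite -[X in _ = X]/((1 + 1) * _) Rmult_plus_distr_r Rmult_1_l; congr (_ + _).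
rewrite (bigID (fun p : ('I_h * T) * ('I_h * T) => (p.2.1 < p.1.1)%N)) /=.
rewrite [X in _ + X]big1 ?Rplus_0_r; last first.
  move=> [v u] /=; rewrite -!leqNgt => le_vu; apply: f_diag; apply: val_inj.
  by apply/eqP; rewrite eqn_leq andbC.
pose swap (p : ('I_h * T) * ('I_h * T)) := (p.2, p.1).
rewrite (reindex swap) /=; last by exists swap => -[].
by apply: eq_big => [[v u]|[v u] _] //=; rewrite -leqNgt andb_idl // => /ltnW.
Qed.


Definition indicator h K (S : {set 'I_h * 'I_K}) (i : 'I_h) (k : nat) : bool :=
  [exists v in S, (v.1 == i) && (v.2 == k :> nat)].

Lemma indicatorE h K (S : {set 'I_h * 'I_K}) (v : 'I_h * 'I_K) : indicator S v.1 v.2 = (v \in S).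
Proof.
apply/exists_inP/idP => [[u uS /andP[/eqP u1 /eqP u2]]|vS]; last by exists v; rewrite ?eqxx.
by rewrite (_ : v = u) //; case: v u u1 u2 {uS} => i k [i' k'] /= -> /val_inj ->.
Qed.

Section Assembly.
Variables (h n d k0 : nat) (adj : rel 'I_h).
Variables (a : 'I_h -> nat -> nat) (e : 'I_h -> nat -> 'I_h -> nat -> nat).
Hypothesis d0 : (0 < d)%N.
Hypothesis d_reg : d_regular d adj.
Hypothesis n0 : (0 < n)%N.
Hypothesis pat : is_pattern adj n d a e k0.
Local Notation K := (Kbound d k0).
Local Notation V := ('I_h * 'I_K)%type.

Lemma fsumE (b : 'I_h -> nat -> nat) (f : 'I_h -> nat -> 'I_h -> nat -> nat) :
  fsum adj n d b f [set: 'I_h * 'I_K * 'I_h * 'I_K] =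
  \big[Rplus/0]_(p : V * V | (p.1.1 < p.2.1)%N) vterm n adj b f p.1 p.2.
Proof.
rewrite /fsum (reindex (fun p : V * V => (p.1.1, p.1.2, p.2.1, p.2.2))) /=; last first.
  exists (fun x => ((x.1.1.1, x.1.1.2), (x.1.2, x.2))); first by move=> [[? ?] [? ?]].
  by move=> [[[? ?] ?] ?].
rewrite /vterm big_mkcond [RHS]big_mkcond; apply: eq_bigr => p _.
by rewrite inE /=; case: (_ < _)%N.
Qed.

Lemma vterm_sub (S : {set V}) v u :
  vterm n adj (sub_a (indicator S) a) (sub_e (indicator S) e) v u =
  if (v \in S) && (u \in S) then vterm n adj a e v u else 0.
Proof.
rewrite /vterm /pterm /sub_a /sub_e !indicatorE.
by case: ifP => _; case: (v \in S); case: (u \in S) => //=; rewrite /Rdiv; ring.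
Qed.

(** The maximum in [potency_tilde] is tested at the full edge set: restriction to [S] changes the
    signed sum by at most the absolute values of the lost terms. The hypothesis runs over ordered
    pairs, so halving turns [2 * x] into [x]. *)
Lemma potency_le (S : {set V}) (x : R) :
  \big[Rplus/0]_(v : V) \big[Rplus/0]_(u : V) Rabs (vterm n adj a e v u) <=
    \big[Rplus/0]_(v in S) \big[Rplus/0]_(u in S) Rabs (vterm n adj a e v u) + 2 * x ->
  potency adj n d K a e
    <= potency_tilde adj n d K (sub_a (indicator S) a) (sub_e (indicator S) e) + x.
Proof.
move=> le_S; have [_ irr _] := d_reg.
pose g (v u : V) := Rabs (vterm n adj a e v u).
pose gS (v u : V) := Rabs (vterm n adj (sub_a (indicator S) a) (sub_e (indicator S) e) v u).
have g_sym v u : g v u = g u v by rewrite /g (vterm_sym d0 d_reg n0 pat).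
have g_diag v u : v.1 = u.1 -> g v u = 0.
  by move=> vu; rewrite /g /vterm /gadj vu irr Rabs_R0.
have gSE v u : gS v u = if (v \in S) && (u \in S) then g v u else 0.
  by rewrite /gS vterm_sub; case: ifP => // _; rewrite Rabs_R0.
have gS_sum : \big[Rplus/0]_(v in S) \big[Rplus/0]_(u in S) g v u =
    \big[Rplus/0]_v \big[Rplus/0]_u gS v u.
  rewrite big_mkcond; apply: eq_bigr => v _; case: (boolP (v \in S)) => vS.
    by rewrite big_mkcond; apply: eq_bigr => u _; rewrite gSE vS.
  by rewrite big1 // => u _; rewrite gSE (negbTE vS).
rewrite (sum_ordered_pairs g_sym g_diag) gS_sum sum_ordered_pairs in le_S; last first.
- by move=> v u vu; rewrite gSE g_diag // if_same.
- by move=> v u; rewrite !gSE g_sym andbC.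
have tilde : Rabs (fsum adj n d (sub_a (indicator S) a) (sub_e (indicator S) e)
    [set: 'I_h * 'I_K * 'I_h * 'I_K]) <=
    potency_tilde adj n d K (sub_a (indicator S) a) (sub_e (indicator S) e).
  exact: (le_bigRmax (fun F => Rabs (fsum adj n d _ _ F))).
apply: Rle_trans (Rplus_le_compat_r _ _ _ tilde); rewrite /potency !fsumE.
set X := \big[_/_]_(_ | _) _; set Y := \big[_/_]_(_ | _) _.
have XY : Rabs (X - Y) <= \big[Rplus/0]_(p : V * V | (p.1.1 < p.2.1)%N) (g p.1 p.2 - gS p.1 p.2).
  rewrite /X /Y /Rminus Ropp_sum -big_split /=.
  apply: Rle_trans (Rabs_sum_le _ _ _) _.
  apply: Rsum_le => p _.
  rewrite gSE vterm_sub /g; case: ifP => _; last by rewrite Ropp_0 Rplus_0_r; lra.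
  by rewrite Rplus_opp_r Rabs_R0; lra.
rewrite /Rminus big_split /= -Ropp_sum in XY.
have := Rabs_triang (X - Y) Y; have -> : X - Y + Y = X by ring.
move: XY le_S; rewrite /Rminus.
move: (\big[_/_]_(_ | _) g _ _) (\big[_/_]_(_ | _) gS _ _) => ? ?; lra.
Qed.

Lemma cost_sumE (b : 'I_h -> nat -> nat) (f : 'I_h -> nat -> 'I_h -> nat -> nat) :
  \big[Rplus/0]_(x : 'I_h * 'I_h | (x.1 < x.2)%N && adj x.1 x.2)
     \big[Rplus/0]_(k < K) \big[Rplus/0]_(k' < K | wadj n h d k k')
        edge_cost n (b x.1 k) (b x.2 k') (f x.1 k x.2 k') =
  \big[Rplus/0]_(p : V * V | (p.1.1 < p.2.1)%N) vcost n adj b f p.1 p.2.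
Proof.
under eq_bigr => x _ do rewrite pair_big_dep /=.
rewrite pair_big_dep /=.
rewrite (reindex (fun p : V * V => ((p.1.1, p.2.1), (p.1.2, p.2.2)))) /=; last first.
  exists (fun z => ((z.1.1, z.2.1), (z.1.2, z.2.2))); first by move=> [[? ?] [? ?]].
  by move=> [[? ?] [? ?]].
rewrite /vcost big_mkcond [RHS]big_mkcond; apply: eq_bigr => p _ /=.
by rewrite /gadj; case: (_ < _)%N => //; case: (adj _ _).
Qed.

Lemma vcost_sub (S : {set V}) v u :
  vcost n adj (sub_a (indicator S) a) (sub_e (indicator S) e) v u =
  if (v \in S) && (u \in S) then vcost n adj a e v u else 0.
Proof.
rewrite /vcost /edge_cost /sub_a /sub_e !indicatorE.
by case: ifP => _; case: (v \in S); case: (u \in S) => //=; rewrite /Rdiv; ring.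
Qed.

Lemma sub_cost_sum (S : {set V}) :
  2 * \big[Rplus/0]_(p : V * V | (p.1.1 < p.2.1)%N)
     vcost n adj (sub_a (indicator S) a) (sub_e (indicator S) e) p.1 p.2 =
  \big[Rplus/0]_(v in S) \big[Rplus/0]_(u in S) vcost n adj a e v u.
Proof.
have [_ irr _] := d_reg.
rewrite -(@sum_ordered_pairs _ _ (vcost n adj (sub_a (indicator S) a) (sub_e (indicator S) e))).
- rewrite [RHS]big_mkcond; apply: eq_bigr => v _; case: (boolP (v \in S)) => vS.
    by rewrite [RHS]big_mkcond; apply: eq_bigr => u _; rewrite vcost_sub vS.
  by rewrite big1 // => u _; rewrite vcost_sub (negbTE vS).
- by move=> v u; rewrite !vcost_sub andbC (vcost_sym d0 d_reg n0 pat).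
- by move=> v u vu; rewrite /vcost /gadj vu irr.
Qed.

Lemma bin_half_gt0 m : (0 < 'C(n, minn m n./2))%N.
Proof.
rewrite bin_gt0 (leq_trans (geq_minr _ _)) //.
by rewrite -[n in (_ <= n)%N]odd_double_half -addnn addnA leq_addl.
Qed.

Lemma vbin_ge0 (b : 'I_h -> nat -> nat) (v : V) : 0 <= vbin n b v.
Proof. by rewrite -ln_1; apply: ln_le; [lra | exact: INR_ge1 (bin_half_gt0 _)]. Qed.

Lemma exp_vbin (b : 'I_h -> nat -> nat) (v : V) :
  exp (vbin n b v) = INR 'C(n, minn (b v.1 v.2) n./2).
Proof. by rewrite exp_ln //; have := INR_ge1 (bin_half_gt0 (b v.1 v.2)); lra. Qed.

Lemma vbin_sub (S : {set V}) v :
  vbin n (sub_a (indicator S) a) v = if v \in S then vbin n a v else 0.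
Proof.
rewrite /vbin /sub_a indicatorE; case: ifP => // _.
by rewrite min0n bin0 ln_1.
Qed.

(** The occupied exponents lie in [[k0, k0 + d]], so their number on a fibre is bounded
    independently of [n] and [k0]. This keeps the final constant uniform. *)
Lemma card_window i : (#|[pred k : 'I_K | (0 < a i k)%N]| <= d.+1)%N.
Proof.
apply: (@leq_trans (\sum_(k < K | (k0 <= k)%N) 1)).
  rewrite sum1_card; apply/subset_leq_card/subsetP => k; rewrite inE => ak.
  change (is_true (k0 <= k)%N); rewrite leqNgt; apply/negP => kk0.
  move: ak; rewrite pat.1 // => -[le_w _]; move: le_w.
  apply: Rlt_not_le; rewrite /wt /Rdiv; apply: Rmult_lt_compat_r.
    apply/Rinv_0_lt_compat/sqrt_lt_R0; have := INR_ge1 n0.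
    by have := INR_ge1 (leq_ltn_trans (leq0n i) (ltn_ord i)); nra.
  by apply: Rlt_pow; [lra | exact/ltP].
rewrite -(big_mkord (fun k => (k0 <= k)%N) (fun _ => 1%N)) /K /Kbound -addnS.
rewrite (big_cat_nat (n := k0)) ?leq_addr //= big_nat_cond big_pred0 ?add0n; last first.
  by move=> k; rewrite leq0n (leqNgt k0 k); case: (k < k0)%N.
rewrite big_mkcond -[X in (_ <= X)%N](addKn k0) -[X in (_ <= X)%N]muln1.
by rewrite -sum_nat_const_nat leq_sum // => k _; case: ifP.
Qed.

(** Choosing the sets and absorbing the Stirling ratios each cost [exp Lam]. The rows of [S] cost at
    least [L/2 * Lam] in total and count each edge twice, so the gain is at least [L/4 * Lam]. *)
Lemma prob_found_sub_le (S : {set V}) (L C : R) : 20 <= L -> 1 <= C ->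
  (forall m, (m <= n)%N -> pow (stirling_ratio m) d <= C * INR 'C(n, minn m n./2)) ->
  (forall v, v \in S -> L / 2 * vbin n a v <= \big[Rplus/0]_(u in S) vcost n adj a e v u) ->
  prob_found n adj d (sub_a (indicator S) a) (sub_e (indicator S) e) <=
    pow (pow C d.+1) h
    * exp ((1 - L / 10) * \big[Rplus/0]_(v : V) vbin n (sub_a (indicator S) a) v).
Proof.
move=> L20 C1 le_C S_ok; set b := sub_a _ a; set f := sub_e _ e.
have b_le i k : (b i k <= a i k)%N by rewrite /b /sub_a; case: ifP.
have f_le i k i' k' : gadj adj n d i k i' k' -> (f i k i' k' <= minn (b i k) (b i' k'))%N.
  move=> /(pat.2.2.2 i k i' k')[_]; rewrite /b /f /sub_a /sub_e.
  by case: (indicator S i k); case: (indicator S i' k'); rewrite ?minn0 ?min0n.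
apply: Rle_trans (prob_found_le K d_reg f_le n0) _.
rewrite cost_sumE.
set Lam := \big[Rplus/0]_(v : V) vbin n b v; set cost := \big[Rplus/0]_(_ | _) _.
have Lam0 : 0 <= Lam by apply: Rsum_ge0 => v _; exact: vbin_ge0.
have cost_ge : L / 4 * Lam <= cost.
  have two_cost : 2 * cost = \big[Rplus/0]_(v in S) \big[Rplus/0]_(u in S) vcost n adj a e v u.
    exact: sub_cost_sum.
  have : L / 2 * Lam <= 2 * cost; last by lra.
  rewrite two_cost /Lam (eq_bigr _ (fun v _ => vbin_sub S v)) -big_mkcond big_distrr /=.
  exact: Rsum_le.
have le_n i (k : 'I_K) : (b i k <= n)%N.
  by apply: leq_trans (b_le i k) _; exact: (pattern_le_n pat (i, k)).
have choices : \big[Rmult/1]_i \big[Rmult/1]_(k < K)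
    (INR 'C(n, b i k) * pow (stirling_ratio (b i k)) d) <= pow (pow C d.+1) h * exp (2 * Lam).
  apply: Rle_trans (_ : \big[Rmult/1]_i (pow C d.+1 *
      \big[Rmult/1]_(k < K) exp (2 * @vbin h n d k0 b (i, k))) <= _).
    apply: Rprod_le => i _; split.
      apply: Rprod_ge0 => k _; apply: Rmult_le_pos; first exact: pos_INR.
      exact/pow_le/Rlt_le/stirling_ratio_gt0.
    (* The constant [C] is charged only where [a] is positive, at most [d + 1] times per fibre;
       elsewhere the left factor is exactly 1. *)
    apply: Rle_trans (_ : \big[Rmult/1]_(k < K) ((if (0 < a i k)%N then C else 1) *
       exp (2 * @vbin h n d k0 b (i, k))) <= _).
      apply: Rprod_le => k _; split.
        apply: Rmult_le_pos; first exact: pos_INR.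
        exact/pow_le/Rlt_le/stirling_ratio_gt0.
      have -> : 2 * @vbin h n d k0 b (i, k) = vbin n b (i, k) + vbin n b (i, k) by ring.
      rewrite exp_plus exp_vbin /=.
      have [ak0|ak0] := posnP (a i k).
        have -> : b i k = 0%N by apply/eqP; rewrite -leqn0 -ak0.
        rewrite min0n !bin0 /stirling_ratio fact0 /= exp_0 /Rdiv Rinv_1 !Rmult_1_r pow1.
        by lra.
      have h1 := leq_INR (bin_le_half (le_n i k)); have h2 := le_C _ (le_n i k).
      have s0 : 0 <= pow (stirling_ratio (b i k)) d by exact/pow_le/Rlt_le/stirling_ratio_gt0.
      apply: Rle_trans (Rmult_le_compat _ _ _ _ (pos_INR _) s0 h1 h2) _.
      by apply: Req_le; ring.
    rewrite big_split /=; apply: Rmult_le_compat_r.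
      by apply: Rprod_ge0 => k _; exact/Rlt_le/exp_pos.
    rewrite -big_mkcond Rprod_const -[C * _]/(pow C d.+1); apply: Rle_pow => //; apply/leP.
    exact: card_window.
  rewrite big_split /= Rprod_const card_ord; apply: Req_le; congr (_ * _).
  rewrite pair_bigA -exp_Rsum -big_distrr /=; congr exp; congr (_ * _).
have C0 : 0 <= pow (pow C d.+1) h by apply/pow_le/pow_le; lra.
apply: Rle_trans (Rmult_le_compat_r _ _ _ (Rlt_le _ _ (exp_pos _)) choices) _.
rewrite -RmultA -exp_plus; apply: Rmult_le_compat_l => //; apply: exp_le.
(* Since [L >= 20], [2 - L/4 <= 1 - L/10]. *)
by nra.
Qed.

End Assembly.

Theorem theorem3p6 :
  forall (h d : nat) (adj : rel 'I_h),
    (2 <= d)%N -> d_regular d adj ->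
  forall L : R, 20 <= L ->
  exists C : R,
  forall n : nat, (0 < n)%N ->
  forall (a : 'I_h -> nat -> nat) (e : 'I_h -> nat -> 'I_h -> nat -> nat) (k0 : nat),
    is_pattern adj n d a e k0 ->
    let K := Kbound d k0 in
    exists S : 'I_h -> nat -> bool,
      potency_tilde adj n d K (sub_a S a) (sub_e S e)
        >= potency adj n d K a e / 2 - 55 * L * sqrt (INR d)
      /\
      prob_found n adj d (sub_a S a) (sub_e S e)
        <= C * (\big[Rmult/1]_(i : 'I_h) \big[Rmult/1]_(k < K | S i k && (0 < a i k)%N)
                   Rpower (INR (a i k)) (INR d / 4))
             * Rpower (INR (\prod_(i : 'I_h) \prod_(k < K | S i k && (0 < a i k)%N)
                               'C(n, minn (a i k) n./2))%N)
                      (1 - L / 10).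
Proof.
move=> h d adj d2 d_reg L L20; have d0 : (0 < d)%N by exact: leq_trans d2.
have [C C1 le_C] := stirling_ratio_pow_le d; exists (pow (pow C d.+1) h).
move=> n n0 a e k0 pat K.
have [S S_ok le_S] := pattern_prune d0 d_reg n0 pat L20.
exists (indicator S); split.
  (* The loss is purely additive, so the whole potency survives up to the error; nonnegativity gives
     the stated half. *)
  have pot0 : 0 <= potency adj n d K a e by exact: Rabs_pos.
  by have := potency_le d0 d_reg n0 pat le_S; rewrite -/K; lra.
apply: Rle_trans (prob_found_sub_le d0 d_reg n0 pat L20 C1 (le_C n) S_ok) _.
set Lam := \big[Rplus/0]_v _.
(* Vertices outside [S] or with [a = 0] contribute [C(n,0) = 1], so the restricted product equals
   the one over the whole window. *)
have prod_bin : INR (\prod_(i : 'I_h) \prod_(k < K | indicator S i k && (0 < a i k)%N)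
    'C(n, minn (a i k) n./2))%N = exp Lam.
  rewrite /Lam exp_Rsum INR_prod.
  rewrite (eq_bigr (fun v : 'I_h * 'I_K =>
    INR 'C(n, minn (sub_a (indicator S) a v.1 v.2) n./2))); last first.
    by move=> v _; rewrite exp_vbin.
  rewrite -(pair_bigA _ (fun i (k : 'I_K) => INR 'C(n, minn (sub_a (indicator S) a i k) n./2))) /=.
  apply: eq_bigr => i _; rewrite INR_prod big_mkcond; apply: eq_bigr => k _.
  rewrite /sub_a; case: (indicator S i k) => /=; last by rewrite min0n bin0.
  by have [->|_] := posnP (a i k); first by rewrite min0n bin0.
rewrite prod_bin /Rpower ln_exp; apply: Rmult_le_compat_r; first exact/Rlt_le/exp_pos.
(* The product of the [a^(d/4)] has all factors at least 1, so inserting it only enlarges the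
   right-hand side. *)
rewrite -[X in X <= _]Rmult_1_r; apply: Rmult_le_compat_l; first by apply/pow_le/pow_le; lra.
apply: Rprod_ge1 => i _; apply: Rprod_ge1 => k /andP[_ ak].
rewrite -exp_0; apply: exp_le; apply: Rmult_le_pos.
  by have := pos_INR d; lra.
by rewrite -ln_1; apply: ln_le; [lra | exact: INR_ge1].
Qed.
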